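(* Let $n\geq 4$, let $G$ be a simple graph on the vertex set $[n]=\{1,\dots,n\}$ with no isolated vertices, and let $I=I(G)\subset S=K[x_1,\dots,x_n]$ be its edge ideal. The following conditions are equivalent: (a) the complement $\bar{G}$ of $G$ is a cycle of length $n$; (b) $\operatorname{index}(I)=\operatorname{proj\,dim}(I)$. If the equivalent conditions hold, then $\operatorname{proj\,dim}(I)=n-3$.
   Context: $K$ is a field and $S=K[x_1,\dots,x_n]$ is the standard graded polynomial ring. The edge ideal of a simple graph $G$ on $[n]$ is the ideal of $S$ generated by the monomials $x_ix_j$ with $\{i,j\}\in E(G)$. The complement $\bar G$ is the simple graph on $[n]$ whose edges are the non-edges of $G$. $\operatorname{proj\,dim}(I)$ is the projective dimension of $I$ as an $S$-module. For a nonzero graded ideal $J\subset S$ generated in a single degree $d$, with graded Betti numbers $\beta_{i,j}(J)=\dim_K\operatorname{Tor}_i^S(J,K)_j$, $J$ is called $r$ steps linear if $\beta_{i,i+j}(J)=0$ for all pairs $(i,j)$ with $0\leq i\leq r$ and $j>d$. The index of $J$ is $\operatorname{index}(J)=\sup\{r : J \text{ is } r \text{ steps linear}\}+1$ (so $\operatorname{index}(J)=\infty$ if and only if $J$ has a linear resolution). *)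

(* Defs.v *)
From Stdlib Require Import ClassicalEpsilon.
From HB Require Import structures.
From mathcomp Require Import all_boot all_order all_algebra all_fingroup.
From mathcomp Require Import mpoly.

Set Implicit Arguments.
Unset Strict Implicit.
Unset Printing Implicit Defensive.

Import GRing.Theory.
Local Open Scope ring_scope.

(* Extended natural numbers: [None] is infinity. *)
Definition enat_le (x y : option nat) : Prop :=
  match x, y with
  | _, None => True
  | None, Some _ => False
  | Some a, Some b => (a <= b)%N
  end.

Definition is_esup (A : nat -> Prop) (s : option nat) : Prop :=
  (forall r, A r -> enat_le (Some r) s) /\
  (forall t, (forall r, A r -> enat_le (Some r) t) -> enat_le s t).

Definition is_einf (A : nat -> Prop) (s : option nat) : Prop :=
  (forall r, A r -> enat_le s (Some r)) /\
  (forall t, (forall r, A r -> enat_le t (Some r)) -> enat_le t s).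

(* Both exist and are unique for every [A]; the infimum of the empty set is
   infinity. *)
Definition esup (A : nat -> Prop) : option nat :=
  epsilon (inhabits None) (is_esup A).

Definition einf (A : nat -> Prop) : option nat :=
  epsilon (inhabits None) (is_einf A).

Definition ideal_gen (R : comNzRingType) (A : R -> Prop) (p : R) : Prop :=
  exists (m : nat) (c g : 'I_m -> R),
    (forall k, A (g k)) /\ p = \sum_(k < m) c k * g k.

Definition edge_ideal (K : fieldType) (n : nat) (e : rel 'I_n) :
    {mpoly K[n]} -> Prop :=
  ideal_gen (fun p => exists i j : 'I_n, e i j /\ p = 'X_i * 'X_j).

Definition compl_graph (n : nat) (e : rel 'I_n) : rel 'I_n :=
  fun i j => (i != j) && ~~ e i j.

(* [s] lists the vertices in cyclic order; [ordS] is the successor mod [n].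
   This is the n-cycle only when [n >= 3]. *)
Definition is_cycle_graph (n : nat) (e : rel 'I_n) : Prop :=
  exists s : {perm 'I_n},
    forall i j, e (s i) (s j) = (j == ordS i) || (i == ordS j).

Definition projective (R : nzRingType) (P : lmodType R) : Prop :=
  forall (M N : lmodType R) (g : {linear M -> N}) (f : {linear P -> N}),
    (forall y, exists x, g x = y) ->
    exists h : {linear P -> M}, forall x, g (h x) = f x.

(* A resolution ... -> P_1 -> P_0 -> J -> 0 of the ideal [J]; the augmentation
   is taken with values in [R], with image [J]. *)
Record projective_resolution (R : comNzRingType) (J : R -> Prop) := {
  pr_mod : nat -> lmodType R;
  pr_aug : {linear pr_mod 0 -> R^o};
  pr_diff : forall i, {linear pr_mod i.+1 -> pr_mod i};
  pr_projective : forall i, projective (pr_mod i);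
  pr_image : forall p : R, J p <-> exists x, pr_aug x = p;
  pr_exact0 : forall x, pr_aug x = 0 <-> exists y, pr_diff 0 y = x;
  pr_exactS : forall i x,
    pr_diff i x = 0 <-> exists y, pr_diff i.+1 y = x
}.

Definition proj_dim (R : comNzRingType) (J : R -> Prop) : option nat :=
  einf (fun d => exists F : projective_resolution J,
    forall i, (d < i)%N -> forall x : pr_mod F i, x = 0).

(* Resolutions of a graded ideal [J] of S = K[x_1, ..., x_n] by graded free
   modules F_i = \bigoplus_k S(- gf_deg i k) of finite rank.  Elements of F_i
   are row vectors, the differential F_{i+1} -> F_i is [v |-> v *m gf_diff i],
   and the k-th basis element of F_i is homogeneous of degree [gf_deg i k]. *)
Record graded_free_resolution (K : fieldType) (n : nat)
    (J : {mpoly K[n]} -> Prop) := {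
  gf_rank : nat -> nat;
  gf_deg : forall i, 'I_(gf_rank i) -> nat;
  gf_aug : 'cV[{mpoly K[n]}]_(gf_rank 0);
  gf_diff : forall i, 'M[{mpoly K[n]}]_(gf_rank i.+1, gf_rank i);
  gf_aug_homog : forall k, gf_aug k 0 \is (gf_deg k).-homog;
  gf_diff_homog : forall i k l m,
    m \in msupp (gf_diff i k l) -> (mdeg m + gf_deg l)%N = gf_deg k;
  gf_image : forall p,
    J p <-> exists v : 'rV_(gf_rank 0), (v *m gf_aug) 0 0 = p;
  gf_exact0 : forall v : 'rV_(gf_rank 0),
    v *m gf_aug = 0 <-> exists w, w *m gf_diff 0 = v;
  gf_exactS : forall i (v : 'rV_(gf_rank i.+1)),
    v *m gf_diff i = 0 <-> exists w, w *m gf_diff i.+1 = v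
}.

Section Tor.
Variables (K : fieldType) (n : nat) (J : {mpoly K[n]} -> Prop).
Variable F : graded_free_resolution J.

(* The complex F \otimes_S K, where K = S / (x_1, ..., x_n): its i-th term is
   K ^ (gf_rank F i), and its differential is obtained from that of F by taking
   constant coefficients. *)
Definition tor_diff (i : nat) : 'M[K]_(gf_rank F i.+1, gf_rank F i) :=
  map_mx (fun p : {mpoly K[n]} => p@_0%MM) (gf_diff F i).

(* The degree j component of the i-th term. *)
Definition tor_part (i j : nat) : 'M[K]_(gf_rank F i) :=
  diag_mx (\row_k (gf_deg (g := F) k == j)%:R).

(* The augmentation is not part of the complex, so everything in homological
   degree 0 is a cycle. *)
Definition tor_cycles (i : nat) : 'M[K]_(gf_rank F i) :=
  match i with
  | 0%N => 1%:M
  | i'.+1 => kermx (tor_diff i')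
  end.

(* Dimension of cycles modulo boundaries in degree j: the boundaries are the
   image of the degree j component. *)
Definition tor_dim (i j : nat) : nat :=
  (\rank (tor_part i j :&: tor_cycles i)
   - \rank (tor_part i.+1 j *m tor_diff i))%N.

End Tor.

(* \beta_{i,j}(J) = dim_K Tor_i(J, K)_j; the value does not depend on the
   chosen resolution. *)
Definition betti (K : fieldType) (n : nat) (J : {mpoly K[n]} -> Prop)
    (i j : nat) : nat :=
  epsilon (inhabits 0%N)
    (fun b => exists F : graded_free_resolution J, tor_dim F i j = b).

Definition generated_in_degree (K : fieldType) (n : nat)
    (J : {mpoly K[n]} -> Prop) (d : nat) : Prop :=
  (exists p, J p /\ p <> 0) /\
  (forall p, J p <-> ideal_gen (fun q => J q /\ q \is d.-homog) p).

(* The degree [d] is determined by [J]. *)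
Definition steps_linear (K : fieldType) (n : nat)
    (J : {mpoly K[n]} -> Prop) (r : nat) : Prop :=
  exists d, generated_in_degree J d /\
    forall i j, (i <= r)%N -> (d < j)%N -> betti J i (i + j) = 0%N.

(* Meaningful for nonzero graded ideals generated in a single degree, which are
   all 0 steps linear. *)
Definition lin_index (K : fieldType) (n : nat) (J : {mpoly K[n]} -> Prop) :
    option nat :=
  omap S (esup (steps_linear J)).

(* Main.v *)
From Stdlib Require Import Classical ClassicalEpsilon.
From HB Require Import structures.
From mathcomp Require Import all_boot all_algebra all_fingroup.
From mathcomp Require Import freeg mpoly.
From mathcomp Require Import zify ring.
Require Import Defs.

Set Implicit Arguments.
Unset Strict Implicit.
Unset Printing Implicit Defensive.

Import GRing.Theory.
Local Open Scope ring_scope.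

(** Let D_U be the independence complex of G on a vertex set U, that is, the
    clique complex of the complement. The Koszul homology of I splits into
    multidegrees: in a squarefree multidegree U it is, up to duality, the
    cohomology of D_U, and it vanishes in the others. Dimension shifting
    identifies it with the Tor computed from any resolution, so both invariants
    are read off from the sets U and the dimensions in which D_U has cohomology;
    the projective dimension is attained by a minimal graded free resolution,
    which exists because the Koszul homology is bounded in degree.

    Suppose both invariants equal d, and let W be minimal such that D_W has
    cohomology in some positive dimension. The exact sequence of the link of a
    vertex shows that this dimension is 1, hence |W| = d + 3. As Tor_{d+1}
    vanishes, every vertex outside W is joined in the complement to all of W;
    two such vertices adjacent in G would span, with W, a suspension of D_W,
    again contradicting the vanishing of Tor_{d+1}. So W is the whole vertex set.
    Two vertices in different components of the link of v, joined by a shortest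
    path avoiding v, close up through v to an induced cycle, which is everything
    by minimality. Conversely, if the complement is an n-cycle, then a minimal W
    is closed under passing to the next vertex of the cycle. *)

(** Both invariants depend only on which Tor modules vanish, so no homology group is formed:
    vanishing is stated as exactness ([exC], [exA], [kex]), and connecting maps enter through
    injectivity statements ([kinj]). The obstacle is that [proj_dim] ranges over arbitrary
    projective resolutions without grading, whereas [betti] uses graded free ones. The Koszul
    complex is the common yardstick; its coefficients are families of subsets, so that one
    dimension-shifting argument covers both whole modules and strands of a single degree, which are
    not submodules. The bookkeeping is |U| = k + i + 1 for homological degree i and cohomology in
    dimension k - 1: the index sees k > 1 only, the projective dimension sees all k. The graded
    resolution serves twice, since it also keeps the choice in [betti] from being a default
    value. *)

Lemma choice_fun (A B : Type) (R : A -> B -> Prop) :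
  (forall x, exists y, R x y) -> exists f, forall x, R x (f x).
Proof.
move=> h; exists (fun x => proj1_sig (constructive_indefinite_description _ (h x))).
by move=> x; case: constructive_indefinite_description.
Qed.

(** * Koszul differentials and simplicial chains *)

Section Koszul.
Variable n : nat.
Implicit Types (k l v : 'I_n) (A B s t U : {set 'I_n}).

Section Diff.
Variables (R : comNzRingType) (M : lmodType R) (x : 'I_n -> R).
Implicit Types (f g : {set 'I_n} -> M).

Definition ksign k A : R := \prod_(l in A) (-1) ^+ (l < k)%N.

Lemma ksignU1 k l A : l \notin A ->
  ksign k (l |: A) = (-1) ^+ (l < k)%N * ksign k A.
Proof. by move=> lA; rewrite /ksign big_setU1. Qed.

Lemma ksign_sqr k A : ksign k A * ksign k A = 1.
Proof.
rewrite /ksign -big_split /= big1 // => l _.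
by rewrite -expr2 sqrr_sign.
Qed.

Lemma ksign0 k : ksign k set0 = 1.
Proof. by rewrite /ksign big_set0. Qed.

Lemma ksign_anti k l A : k != l -> k \notin A -> l \notin A ->
  ksign k A * ksign l (k |: A) = - (ksign l A * ksign k (l |: A)).
Proof.
move=> kl kA lA; rewrite !ksignU1 //.
have : (k < l)%N = ~~ (l < k)%N.
  by rewrite -leqNgt ltn_neqAle; move: kl; rewrite -(inj_eq val_inj) /= => ->.
by case: (l < k)%N => ->; rewrite ?expr0 ?expr1; ring.
Qed.

(** A chain assigns to [s] its coefficient at the basis element $e_s$, so contraction shows up at
    [s] as a sum over sets with one more element. Taking all [x k] equal to 1 gives the simplicial
    boundary. *)
Definition kdiff f s : M := \sum_(k | k \notin s) (ksign k s * x k) *: f (k |: s).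

Lemma eq_kdiff f g s : (forall k, k \notin s -> f (k |: s) = g (k |: s)) ->
  kdiff f s = kdiff g s.
Proof. by move=> e; apply: eq_bigr => k ks; rewrite e. Qed.

Lemma kdiff_eq0 f s : (forall k, k \notin s -> f (k |: s) = 0) -> kdiff f s = 0.
Proof. by move=> e; apply: big1 => k ks; rewrite e // scaler0. Qed.

Lemma kdiffD f g s : kdiff (fun t => f t + g t) s = kdiff f s + kdiff g s.
Proof. by rewrite /kdiff -big_split /=; apply: eq_bigr => k _; rewrite scalerDr. Qed.

Lemma kdiffN f s : kdiff (fun t => - f t) s = - kdiff f s.
Proof. by rewrite /kdiff -sumrN /=; apply: eq_bigr => k _; rewrite scalerN. Qed.

Lemma kdiffB f g s : kdiff (fun t => f t - g t) s = kdiff f s - kdiff g s.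
Proof. by rewrite kdiffD kdiffN. Qed.

Lemma kdiff_sum (I : Type) (r : seq I) (F : I -> {set 'I_n} -> M) s :
  kdiff (fun t => \sum_(i <- r) F i t) s = \sum_(i <- r) kdiff (F i) s.
Proof.
rewrite /kdiff exchange_big /=; apply: eq_bigr => k _.
by rewrite scaler_sumr.
Qed.

Lemma kdiff_kdiff f s : kdiff (kdiff f) s = 0.
Proof.
pose G (p : 'I_n * 'I_n) :=
  (ksign p.1 s * x p.1 * (ksign p.2 (p.1 |: s) * x p.2)) *: f (p.2 |: (p.1 |: s)).
have -> : kdiff (kdiff f) s =
    \sum_(p | [&& p.1 \notin s, p.2 \notin s & p.1 != p.2]) G p.
  rewrite /kdiff.
  under eq_bigr => k ks do rewrite scaler_sumr.
  rewrite pair_big_dep /=; apply: eq_big => [[k l]|[k l] _] /=.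
    by rewrite !inE negb_or (eq_sym l); case: (k \notin s) (l \notin s) (k != l) => [] [] [].
  by rewrite scalerA.
rewrite (bigID (fun p : 'I_n * 'I_n => (p.1 < p.2)%N)) /=.
rewrite [X in _ + X](reindex_inj (h := fun p : 'I_n * 'I_n => (p.2, p.1))) /=; last first.
  by move=> [a b] [c d] [-> ->].
rewrite -[X in X + _]opprK -sumrN.
apply/eqP; rewrite addrC subr_eq0; apply/eqP; apply: eq_big => [[k l]|[k l]] /=.
  rewrite -leqNgt (eq_sym l) leq_eqVlt.
  case: (eqVneq k l) => [->|kl]; rewrite ?andbF //=.
  rewrite (negbTE (_ : k != l :> nat)) /=; last by rewrite -(inj_eq val_inj) in kl.
  by rewrite andbC -!andbA; case: (k \notin s) (l \notin s) (k < l)%N => [] [] [].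
case/andP=> /and3P[ls ks kl] _; rewrite /G /= setUCA -scaleNr; congr (_ *: _).
have := ksign_anti kl ls ks; rewrite /= => e.
ring: e.
Qed.


End Diff.

Section Simplicial.
Variable K : fieldType.
Implicit Types (f g : {set 'I_n} -> K).

Definition bdry f s : K := \sum_(k | k \notin s) ksign K k s * f (k |: s).

Lemma bdryE f s : bdry f s = kdiff (fun=> 1) (f : _ -> K^o) s.
Proof. by apply: eq_bigr => k _; rewrite mulr1. Qed.

Lemma eq_bdry f g s : (forall k, k \notin s -> f (k |: s) = g (k |: s)) ->
  bdry f s = bdry g s.
Proof. by move=> h; apply: eq_bigr => k ks; rewrite h. Qed.

Lemma bdry_eq0 f s : (forall k, k \notin s -> f (k |: s) = 0) -> bdry f s = 0.
Proof. by move=> h; apply: big1 => k ks; rewrite h // mulr0. Qed.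

Lemma bdryD f g s : bdry (fun t => f t + g t) s = bdry f s + bdry g s.
Proof. by rewrite /bdry -big_split /=; apply: eq_bigr => k _; rewrite mulrDr. Qed.

Lemma bdryN f s : bdry (fun t => - f t) s = - bdry f s.
Proof. by rewrite /bdry -sumrN; apply: eq_bigr => k _; rewrite mulrN. Qed.

Lemma bdryB f g s : bdry (fun t => f t - g t) s = bdry f s - bdry g s.
Proof. by rewrite bdryD bdryN. Qed.

Lemma bdry_bdry f s : bdry (bdry f) s = 0.
Proof.
rewrite bdryE -[RHS](kdiff_kdiff (fun=> 1) (f : _ -> K^o) s).
by rewrite /kdiff; apply: eq_bigr => k _; rewrite bdryE.
Qed.

Definition cone v f s : K :=
  if v \in s then ksign K v (s :\ v) * f (s :\ v) else 0.

(** The homotopy formula: on cycles, coning is a right inverse of the boundary. *)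
Lemma bdry_cone v f s : bdry (cone v f) s = f s - cone v (bdry f) s.
Proof.
rewrite [cone v (bdry f) s]/cone; case: ifPn => vs.
  have vt : v \notin s :\ v by rewrite !inE eqxx.
  rewrite [bdry f (s :\ v)]/bdry (bigD1 v) //= setD1K // mulrDr mulrA.
  rewrite ksign_sqr mul1r opprD addNKr mulr_sumr -sumrN /bdry.
  apply: eq_big => [k|k ks].
    by rewrite !inE negb_and negbK; case: eqVneq => [->|]; rewrite ?vs ?andbT.
  have kv : k != v by apply: contraNneq ks => ->.
  have kt : k \notin s :\ v by rewrite !inE (negbTE ks) andbF.
  rewrite /cone !inE vs orbT.
  have -> : (k |: s) :\ v = k |: (s :\ v).
    by apply/setP => j; rewrite !inE; case: (eqVneq j k) => [->|] //=; rewrite kv.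
  have := ksign_anti K kv kt vt; rewrite setD1K // => a.
  rewrite !mulrA -mulNr; congr (_ * _).
  have a1 := ksign_sqr K k (s :\ v); have a2 := ksign_sqr K k s.
  transitivity (ksign K k (s :\ v) * (ksign K k (s :\ v) * ksign K v (k |: s :\ v)) * ksign K k s).
    by rewrite mulrA a1 mul1r mulrC.
  by rewrite a mulrN mulNr -!mulrA a2 mulr1; ring.
rewrite subr0 /bdry (bigD1 v) //= big1 ?addr0.
  rewrite /cone setU11 setU1K // mulrA ksign_sqr mul1r //.
move=> k /andP[ks kv]; rewrite /cone !inE eq_sym (negbTE kv) (negbTE vs) /=.
by rewrite mulr0.
Qed.

(** Conjugation by complements lets every identity of the boundary carry over; the price is that
    signs are taken relative to the complement of [s]. *)
Definition cobd f s : K := bdry (fun t => f (~: t)) (~: s).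

Lemma cobdE f s : cobd f s = \sum_(k in s) ksign K k (~: s) * f (s :\ k).
Proof.
apply: eq_big => [k|k]; first by rewrite inE negbK.
by move=> _; rewrite setCU setCK setIC setDE.
Qed.

Lemma eq_cobd f g s : (forall k, k \in s -> f (s :\ k) = g (s :\ k)) ->
  cobd f s = cobd g s.
Proof. by move=> h; rewrite !cobdE; apply: eq_bigr => k ks; rewrite h. Qed.

Lemma cobd_eq0 f s : (forall k, k \in s -> f (s :\ k) = 0) -> cobd f s = 0.
Proof. by move=> h; rewrite !cobdE big1 // => k ks; rewrite h ?mulr0. Qed.

Lemma cobdD f g s : cobd (fun t => f t + g t) s = cobd f s + cobd g s.
Proof. exact: bdryD. Qed.

Lemma cobdN f s : cobd (fun t => - f t) s = - cobd f s.
Proof. exact: bdryN. Qed.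

Lemma cobdB f g s : cobd (fun t => f t - g t) s = cobd f s - cobd g s.
Proof. exact: bdryB. Qed.

Lemma cobd_cobd f s : cobd (cobd f) s = 0.
Proof.
by rewrite /cobd -[RHS](bdry_bdry (fun t => f (~: t)) (~: s)); apply: eq_bdry => k _; rewrite setCK.
Qed.

Definition cocone v f s : K :=
  if v \notin s then ksign K v (~: (v |: s)) * f (v |: s) else 0.

Lemma cobd_cocone v f s : cobd (cocone v f) s = f s - cocone v (cobd f) s.
Proof.
have coE h t : cocone v h t = cone v (fun t => h (~: t)) (~: t).
  by rewrite /cocone /cone inE setCD setCK setDE -setCU setUC.
rewrite coE /cobd; transitivity (bdry (cone v (fun t => f (~: t))) (~: s)).
  by apply: eq_bdry => k _; rewrite coE setCK.
rewrite bdry_cone setCK; congr (_ - _).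
by rewrite /cone; case: ifP => // _; rewrite setCK.
Qed.

(* [uncocone v h] is the cochain vanishing away from [v] with
   [cocone v (uncocone v h) = h] away from [v]. *)
Definition uncocone v f s : K :=
  if v \in s then ksign K v (~: s) * f (s :\ v) else 0.

Lemma cocone_uncocone v f s : v \notin s -> cocone v (uncocone v f) s = f s.
Proof.
move=> vs; rewrite /cocone vs /uncocone setU11 setU1K // mulrA ksign_sqr mul1r //.
Qed.

Lemma uncocone0 v f s : v \notin s -> uncocone v f s = 0.
Proof. by rewrite /uncocone => /negbTE->. Qed.

Lemma coconeD v f g s : cocone v (fun t => f t + g t) s = cocone v f s + cocone v g s.
Proof. by rewrite /cocone; case: ifP; rewrite ?mulrDr ?addr0. Qed.

Lemma cocone_inj v f g s : v \notin s -> cocone v f s = cocone v g s ->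
  f (v |: s) = g (v |: s).
Proof.
move=> vs; rewrite /cocone vs => /(congr1 (fun z => ksign K v (~: (v |: s)) * z)).
by rewrite !mulrA ksign_sqr !mul1r.
Qed.

End Simplicial.
End Koszul.

(** * Cohomology of independence complexes *)

Section Independence.
Variables (K : fieldType) (n : nat) (e : rel 'I_n).
Hypotheses (e_sym : ssrbool.symmetric e) (e_irr : irreflexive e).
Implicit Types (l v : 'I_n) (k m : nat) (s t U : {set 'I_n}) (f g : {set 'I_n} -> K).

Definition stable s := [forall i in s, forall j in s, ~~ e i j].

Lemma stableP s : reflect (forall i j, i \in s -> j \in s -> ~~ e i j) (stable s).
Proof.
apply: (iffP 'forall_in_forall_inP) => h i; last by move=> js j; apply: h.
by move=> j si sj; apply: h.
Qed.

Lemma stableS s t : s \subset t -> stable t -> stable s.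
Proof.
by move=> /subsetP st /stableP h; apply/stableP => i j /st si /st sj; apply: h.
Qed.

Definition conbr U v := [set u in U | ~~ e v u].

Lemma conbrS U v : conbr U v \subset U.
Proof. by apply/subsetP => u; rewrite inE => /andP[]. Qed.

Lemma stableU1 U v s : v \notin U -> s \subset U ->
  stable (v |: s) = (s \subset conbr U v) && stable s.
Proof.
move=> vU sU; apply/stableP/andP => [h|[sN hs] i j].
  split; last by apply/stableP => i j si sj; apply: h; rewrite !inE ?si ?sj orbT.
  apply/subsetP => u us; rewrite inE (subsetP sU) //=.
  by apply: h; rewrite !inE ?eqxx ?us ?orbT.
have nv u : u \in s -> ~~ e v u.
  by move/(subsetP sN); rewrite inE => /andP[].
rewrite !inE => /predU1P[->|si] /predU1P[->|sj]; rewrite ?e_irr ?nv //.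
  by rewrite e_sym nv.
by apply: (stableP _ hs).
Qed.

(* [exC U k] says that the reduced cohomology of the independence complex of
   [e] restricted to [U] vanishes in dimension [k - 1]. *)
Definition cocycle U k f :=
  forall s, s \subset U -> stable s -> #|s| = k.+1 -> cobd f s = 0.

Definition coboundary U k f :=
  exists g, forall s, s \subset U -> stable s -> #|s| = k -> cobd g s = f s.

Definition exC U k := forall f, cocycle U k f -> coboundary U k f.

Lemma cardsD1_eq s l m : l \in s -> #|s| = m.+1 -> #|s :\ l| = m.
Proof. by move=> ls; rewrite (cardsD1 l s) ls => -[]. Qed.

Section Link.
Variables (U : {set 'I_n}) (v : 'I_n).
Hypothesis vU : v \notin U.
Let N := conbr U v.

Let vS s : s \subset U -> v \notin s.
Proof. by move=> sU; apply: contra vU => /(subsetP sU). Qed.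

Let NU s : s \subset N -> s \subset U.
Proof. by move=> h; apply: subset_trans h (conbrS _ _). Qed.

Let notin_sub s : s \subset v |: U -> v \notin s -> s \subset U.
Proof. by move=> sU vs; rewrite -(setU1K vU) subsetD1 sU vs. Qed.

Let cone_sub s : s \subset v |: U -> stable s -> v \in s ->
  [/\ s = v |: (s :\ v), s :\ v \subset N & stable (s :\ v)].
Proof.
move=> sU st vs; have es : s = v |: (s :\ v) by rewrite setD1K.
have sU' : s :\ v \subset U by rewrite subDset.
by move: st; rewrite {1}es (stableU1 vU) // => /andP[].
Qed.

(** A cochain on [v |: U] amounts to its restriction to [U] and its part [cocone v f] on the link of
    [v]. The coboundary acts on such pairs as in a mapping cone. *)
Lemma cobd_link f s : v \notin s -> cocone v (cobd f) s = f s - cobd (cocone v f) s.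
Proof. by move=> vs; rewrite cobd_cocone opprB addrC subrK. Qed.

Lemma eq_cobd_link f g s : v \notin s ->
  f s - cobd (cocone v f) s = g s -> cobd f (v |: s) = uncocone v g (v |: s).
Proof.
move=> vs h; apply: (cocone_inj vs).
by rewrite cobd_link // cocone_uncocone.
Qed.

(** The link sequence runs from the cohomology of [v |: U] to that of [U], then of the link [N],
    then of [v |: U] one degree up. This is exactness at [U]: a cochain [g] on the link with
    coboundary [f] extends [f] to a cocycle. *)
Lemma exC_del k : exC (v |: U) k -> exC N k -> exC U k.
Proof.
move=> hW hN f fU.
have [g gP] : coboundary N k f.
  by apply: hN => s sN st sk; apply: fU => //; apply: NU.
pose F s := (if v \in s then 0 else f s) + uncocone v g s.
have F0 s : v \notin s -> F s = f s.
  by move=> vs; rewrite /F (negbTE vs) uncocone0 // addr0.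
have F1 s : v \notin s -> cocone v F s = g s.
  move=> vs; rewrite coconeD cocone_uncocone // /cocone vs setU11 mulr0.
  by rewrite add0r.
have [s sW st sk|G GP] := hW F.
  have [vs|vs] := boolP (v \in s); last first.
    rewrite -(fU s _ st sk); last exact: notin_sub.
    apply: eq_cobd => j js; rewrite F0 //.
    by apply: contra vs; apply/subsetP/subD1set.
  have [es sN st'] := cone_sub sW st vs.
  have vn : v \notin s :\ v by rewrite !inE eqxx.
  rewrite es (@eq_cobd_link _ (fun=> 0)) //; first by rewrite /uncocone; case: ifP; rewrite ?mulr0.
  rewrite F0 // -(gP _ sN st' (cardsD1_eq vs sk)); apply/eqP; rewrite subr_eq0; apply/eqP.
  by apply: eq_cobd => j js; rewrite F1 // !inE eqxx andbF.
exists G => s sU st sk; rewrite GP ?F0 ?vS //.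
by apply: subset_trans sU _; apply: subsetUr.
Qed.

(** Exactness at the link; the connecting map is [uncocone v], extension by zero. *)
Lemma exC_link k : exC U k -> exC (v |: U) k.+1 -> exC N k.
Proof.
move=> hU hW f fN.
have vD s j : v \notin s -> v \notin s :\ j by rewrite inE negb_and => ->; rewrite orbT.
have [s sW st sk|G GP] := hW (uncocone v f).
  have [vs|vs] := boolP (v \in s); last first.
    by apply: cobd_eq0 => j js; rewrite uncocone0 ?vD.
  have [es sN st'] := cone_sub sW st vs.
  have vn : v \notin s :\ v by rewrite !inE eqxx.
  rewrite es (@eq_cobd_link _ (fun=> 0)) //; first by rewrite /uncocone; case: ifP; rewrite ?mulr0.
  rewrite uncocone0 // sub0r (@eq_cobd _ _ _ f) ?fN ?oppr0 ?(cardsD1_eq vs sk) //.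
  by move=> j js; rewrite cocone_uncocone ?(vD _ _ vn).
have [s sU st sk|h hP] := hU G.
  rewrite GP ?uncocone0 ?vS //; exact: subset_trans sU (subsetUr _ _).
(* The link part of [cobd G = uncocone v f] reads [G - cobd (cocone v G) = f], and [G] equals
   [cobd h] on [U]. *)
exists (fun s => h s - cocone v G s) => s sN st sk.
have vs : v \notin s by apply/vS/NU.
rewrite cobdB hP //; last exact: NU.
rewrite -cobd_link // -[RHS](cocone_uncocone f vs) /cocone vs; congr (_ * _).
apply: GP; last by rewrite cardsU1 vs sk.
  by apply: setUS; apply: NU.
by rewrite (stableU1 vU) ?NU // sN.
Qed.

(** Exactness at [v |: U], asking only that cocycles of the link extend to [U] up to coboundaries.
    This form serves where the link itself has cohomology. *)
Lemma exC_glue k :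
  (forall f, cocycle N k f -> exists g h, cocycle U k g /\
    forall s, s \subset N -> stable s -> #|s| = k -> f s = g s + cobd h s) ->
  exC U k.+1 -> exC (v |: U) k.+1.
Proof.
move=> ext hU F FW.
have vD s j : v \notin s -> v \notin s :\ j by rewrite inE negb_and => ->; rewrite orbT.
have vn s : v \notin s :\ v by rewrite !inE eqxx.
have [s sU st sk|h hP] := hU F.
  by apply: FW => //; apply: subset_trans sU (subsetUr _ _).
pose F' s := F s - cobd h s.
have F'U s : s \subset U -> stable s -> #|s| = k.+1 -> F' s = 0.
  by move=> sU st sk; rewrite /F' hP // subrr.
have F'W : cocycle (v |: U) k.+1 F'.
  by move=> s sW st sk; rewrite cobdB FW // cobd_cobd subrr.
have [s sN st sk|g [c [gP gc]]] := ext (cocone v F').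
  have vs : v \notin s by apply/vS/NU.
  have := cobd_link F' vs; rewrite F'U ?NU // sub0r => /eqP.
  rewrite eq_sym eqr_oppLR => /eqP->; rewrite /cocone vs F'W ?mulr0 ?oppr0 //.
  - by apply: setUS; apply: NU.
  - by rewrite (stableU1 vU) ?NU // sN.
  - by rewrite cardsU1 vs sk.
(* Restriction [g] and link part [- c] produce a coboundary with link part [g + cobd c], which is
   the link part of [F']. *)
pose G s := (if v \in s then 0 else g s) - uncocone v c s.
have G0 s : v \notin s -> G s = g s.
  by move=> vs; rewrite /G (negbTE vs) uncocone0 // subr0.
have G1 s : v \notin s -> cocone v G s = - c s.
  move=> vs; rewrite coconeD /cocone vs setU11 mulr0 add0r mulrN; congr (- _).
  by rewrite -[RHS](cocone_uncocone c vs) /cocone vs.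
exists (fun s => G s + h s) => s sW st sk.
rewrite cobdD; apply/eqP; rewrite eq_sym -subr_eq eq_sym -/(F' s); apply/eqP.
have [vs|vs] := boolP (v \in s); last first.
  rewrite F'U //; last exact: notin_sub.
  rewrite -(gP s _ st sk); last exact: notin_sub.
  by apply: eq_cobd => j js; rewrite G0 // vD.
have [es sN st'] := cone_sub sW st vs.
rewrite es; apply: (cocone_inj (vn _)); rewrite cobd_link ?vn // G0 ?vn //.
rewrite gc ?(cardsD1_eq vs sk) //; congr (_ + _).
rewrite -cobdN; apply: eq_cobd => j js.
by rewrite G1 ?opprK ?(vD _ _ (vn _)).
Qed.

Lemma exC_add k : exC N k -> exC U k.+1 -> exC (v |: U) k.+1.
Proof.
move=> hN; apply: exC_glue => f /hN[h hP]; exists (fun=> 0), h; split.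
  by move=> s *; apply: cobd_eq0.
by move=> s *; rewrite add0r hP.
Qed.

End Link.

End Independence.

(** * Alexander duality *)

Section Duality.
Variables (K : fieldType) (n : nat) (e : rel 'I_n).
Implicit Types (l v : 'I_n) (i k m : nat) (s t U : {set 'I_n}) (f g : {set 'I_n} -> K).

(* Exactness at the faces with [i] vertices of the augmented chain complex of
   the simplicial complex [A]. *)
Definition exA (A : pred {set 'I_n}) i := forall f : {set 'I_n} -> K,
  (forall s, f s != 0 -> A s /\ #|s| = i) -> (forall s, bdry f s = 0) ->
  exists g : {set 'I_n} -> K,
    (forall s, g s != 0 -> A s /\ #|s| = i.+1) /\ forall s, bdry g s = f s.

Lemma exA_cone (A : pred {set 'I_n}) v i :
  (forall s, A s -> A (v |: s)) -> exA A i.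
Proof.
move=> Av f fA f0; exists (cone v f); split => s; last first.
  by rewrite bdry_cone /cone f0 mulr0; case: ifP; rewrite subr0.
rewrite /cone; case: ifPn => vs; last by rewrite eqxx.
rewrite mulf_eq0 negb_or => /andP[_ /fA[As si]].
split; last by rewrite (cardsD1 v) vs si.
by rewrite -(setD1K vs); apply: Av.
Qed.

Lemma ksignU v s t : [disjoint s & t] ->
  ksign K v (s :|: t) = ksign K v s * ksign K v t.
Proof.
move=> d; rewrite /ksign -bigU //=.
by apply: eq_bigl => l; rewrite !inE.
Qed.

(** At [U :\: s] the coboundary takes signs relative to the union of [s] and [~: U]; the twist
    absorbs the contribution of [~: U]. *)
Definition twist U s : K := \prod_(l in s) ksign K l (~: U).

Lemma twist_sqr U s : twist U s * twist U s = 1.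
Proof. by rewrite -big_split /= big1 // => l _; rewrite ksign_sqr. Qed.

Lemma cobd_twist U s f : (forall t, f t != 0 -> t \subset U) -> s \subset U ->
  cobd (fun t => twist U (U :\: t) * f (U :\: t)) (U :\: s) = twist U s * bdry f s.
Proof.
move=> fU sU; rewrite cobdE mulr_sumr [RHS](bigID (mem U)) /=.
rewrite [X in _ + X]big1 ?addr0; last first.
  move=> l /andP[_ lU]; suff -> : f (l |: s) = 0 by rewrite !mulr0.
  by apply/eqP; apply: contraNT lU => /fU; rewrite subUset sub1set => /andP[].
apply: eq_big => l; first by rewrite inE.
rewrite inE => /andP[ls lU].
have -> : U :\: ((U :\: s) :\ l) = l |: s.
  apply/setP => j; rewrite !inE; case: eqVneq => [->|_] /=; first by rewrite lU.
  by case: (boolP (j \in s)) => [/(subsetP sU)->|] //=; case: (j \in U).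
have -> : ~: (U :\: s) = s :|: ~: U by rewrite setCD setUC.
rewrite ksignU; last by rewrite disjoints_subset setCK.
rewrite /twist big_setU1 //=.
have := ksign_sqr K l (~: U); set a := ksign _ _ (~: U) => a1.
rewrite -/(twist U s) [LHS](_ : _ = (a * a) * (twist U s * (ksign K l s * f (l |: s)))); last by ring.
by rewrite a1 mul1r.
Qed.

(** The upper Koszul complex of the edge ideal in the squarefree multidegree [U]: its faces can be
    divided out without leaving the ideal. It is the Alexander dual of the independence complex on
    [U]. *)
Definition upper U s := (s \subset U) && ~~ stable e (U :\: s).

Lemma setDDs U s : s \subset U -> U :\: (U :\: s) = s.
Proof. by move=> sU; rewrite setDDr setDv set0U; apply/setIidPr. Qed.

Lemma cobd_twistC U s f : (forall t, f t != 0 -> t \subset U) -> s \subset U ->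
  cobd (fun t => twist U (U :\: t) * f (U :\: t)) s =
  twist U (U :\: s) * bdry f (U :\: s).
Proof.
by move=> fU sU; rewrite -(cobd_twist fU) ?subsetDl // setDDs.
Qed.

Lemma twistK U s (a : K) : twist U s * (twist U s * a) = a.
Proof. by rewrite mulrA twist_sqr mul1r. Qed.

Lemma cardsDs U s m i : s \subset U -> #|s| = i -> #|U| = (m + i)%N -> #|U :\: s| = m.
Proof. by move=> sU si Um; rewrite cardsDS // Um si addnK. Qed.


Lemma bdry_supp (P : {set 'I_n} -> Prop) f i :
  (forall l t, l \notin t -> P (l |: t) -> P t) ->
  (forall t, f t != 0 -> P t /\ #|t| = i.+1) ->
  forall s, bdry f s != 0 -> P s /\ #|s| = i.
Proof.
move=> Pd fP s /eqP b; apply: NNPP => h; apply: b.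
apply: bdry_eq0 => l ls; apply/eqP/negPn/negP => /fP[Pl].
by rewrite cardsU1 ls => -[si]; apply: h; split => //; apply: Pd Pl.
Qed.

(** Complements in [U] identify cochains on stable sets with chains of the full simplex on [U]
    relative to [upper U]. The simplex is acyclic because [U] is nonempty, so the sequence of the
    pair shifts the degree by one; hence [k + i.+1]. *)
Lemma exA_exC U i k : #|U| = (k + i.+1)%N -> exA (upper U) i <-> exC K e U k.
Proof.
move=> Uk; have [u uU] : exists u, u \in U.
  by apply/set0Pn; rewrite -cards_eq0 Uk addnS.
have subD l t : l \notin t -> l |: t \subset U -> t \subset U.
  by move=> _; rewrite subUset => /andP[].
have coneU f s m : (forall t, f t != 0 -> t \subset U /\ #|t| = m) ->
    cone u f s != 0 -> s \subset U /\ #|s| = m.+1.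
  move=> fU; rewrite /cone; case: ifPn => us; last by rewrite eqxx.
  rewrite mulf_eq0 negb_or => /andP[_ /fU[sU sm]].
  by rewrite (cardsD1 u) us sm -(setD1K us) subUset sub1set uU.
have coneK f s : bdry f =1 (fun=> 0) -> bdry (cone u f) s = f s.
  by move=> f0; rewrite bdry_cone /cone f0 mulr0; case: ifP; rewrite subr0.
have nst_up l t : l \notin t -> l |: t \subset U -> ~~ stable e (U :\: (l |: t)) ->
    ~~ stable e (U :\: t).
  by move=> _ _; apply/contra/stableS/setDS/subsetUr.
split=> [hA f fC|hC f fA f0].
  pose h s := if (s \subset U) && stable e (U :\: s) && (#|s| == i.+1)
    then twist U s * f (U :\: s) else 0.
  have hU t : h t != 0 -> t \subset U /\ #|t| = i.+1.
    rewrite /h; case: ifPn => [/andP[/andP[-> _] /eqP->]|]; by rewrite ?eqxx.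
  have hU1 t : h t != 0 -> t \subset U by move/hU => [].
  have hf s : s \subset U -> stable e s -> #|s| = k ->
      twist U (U :\: s) * h (U :\: s) = f s.
    move=> sU st sk; rewrite /h subsetDl setDDs // st.
    by rewrite (cardsDs (m := i.+1) sU sk) ?eqxx ?twistK // Uk addnC.
  have bU := bdry_supp subD hU.
  have bA s : bdry h s != 0 -> upper U s /\ #|s| = i.
    move=> b; have [sU si] := bU s b; split => //; rewrite /upper sU /=.
    apply: contraNN b => st; rewrite -(twistK U s (bdry h s)) -cobd_twist //.
    have sk : #|U :\: s| = k.+1 by rewrite (cardsDs (m := k.+1) sU si) // Uk addnS.
    rewrite (@eq_cobd _ _ _ f) ?fC ?mulr0 ?subsetDl // => l ls.
    have ss : U :\: s :\ l \subset U :\: s by apply: subD1set.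
    by rewrite hf ?(subset_trans ss (subsetDl _ _)) ?(stableS ss st) ?(cardsD1_eq ls sk).
  have [h' [h'A h'b]] := hA _ bA (fun s => bdry_bdry h s).
  have dU s : h s - h' s != 0 -> s \subset U /\ #|s| = i.+1.
    case: (eqVneq (h s) 0) => [->|/hU//]; rewrite sub0r oppr_eq0.
    by move=> /h'A[/andP[]].
  have d0 s : bdry (fun s => h s - h' s) s = 0 by rewrite bdryB h'b subrr.
  exists (fun s => twist U (U :\: s) * cone u (fun s => h s - h' s) (U :\: s)).
  move=> s sU st sk; rewrite cobd_twistC //; last by move=> t /(coneU _ _ _ dU)[].
  rewrite coneK // mulrBr hf // [h' _](_ : _ = 0) ?mulr0 ?subr0 //.
  apply/eqP/negPn/negP => /h'A[]; rewrite /upper setDDs // st andbF //.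
have fU t : f t != 0 -> t \subset U /\ #|t| = i by move=> /fA[/andP[]].
pose p := cone u f.
have pU t : p t != 0 -> t \subset U /\ #|t| = i.+1 by apply: coneU.
have pU1 t : p t != 0 -> t \subset U by move=> /pU[].
have [s sU st sk|g gP] := hC (fun s => twist U (U :\: s) * p (U :\: s)).
  rewrite cobd_twistC // coneK //.
  suff -> : f (U :\: s) = 0 by rewrite mulr0.
  by apply/eqP/negPn/negP => /fA[]; rewrite /upper setDDs // st andbF.
pose q s := if (s \subset U) && (#|s| == i.+2) then twist U s * g (U :\: s) else 0.
have qU t : q t != 0 -> t \subset U /\ #|t| = i.+2.
  by rewrite /q; case: ifPn => [/andP[-> /eqP->]|]; rewrite ?eqxx.
(* [p] fills [f] in the simplex, and subtracting the boundary of [q] moves the filling into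
   [upper U]. *)
exists (fun s => p s - bdry q s); split => s; last first.
  by rewrite bdryB bdry_bdry subr0 coneK.
move=> nz; have [sU si] : s \subset U /\ #|s| = i.+1.
  case: (eqVneq (p s) 0) nz => [->|/pU//]; rewrite sub0r oppr_eq0.
  exact: bdry_supp subD qU s.
split=> //; rewrite /upper sU /=; apply: contraNN nz => st.
have sk : #|U :\: s| = k by rewrite (cardsDs (m := k) sU si).
have := gP _ (subsetDl _ _) st sk; rewrite setDDs // => hs.
rewrite -(twistK U s (p s)) -hs -(twistK U s (bdry q s)) -cobd_twist //; last by move=> t /qU[].
rewrite (@eq_cobd _ _ _ g) ?subrr // => l ls.
have ss : U :\: s :\ l \subset U :\: s by apply: subD1set.
have lU : U :\: s :\ l \subset U by apply: subset_trans ss (subsetDl _ _).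
have c : #|U :\: (U :\: s :\ l)| = i.+2.
  move: ls; rewrite inE => /andP[ls lU'].
  rewrite (cardsDs (m := i.+2) lU (erefl _)) // Uk -sk (cardsD1 l (U :\: s)) inE ls lU' /=.
  by rewrite addnC addnA addn1.
by rewrite /q subsetDl c eqxx setDDs // twistK.
Qed.

End Duality.

(** * Koszul homology over a polynomial ring *)

Section Exactness.
Variables (K : fieldType) (n : nat) (M : lmodType {mpoly K[n]}).
Implicit Types (P Z : nat -> M -> Prop) (f g : {set 'I_n} -> M) (s t : {set 'I_n}).

Definition kd f s := kdiff (fun k => 'X_k : {mpoly K[n]}) f s.

Definition chain (Q : M -> Prop) i f := forall s, if #|s| == i then Q (f s) else f s = 0.

Definition kbound P i f := exists g, chain (P i.+1) i.+1 g /\ forall s, kd g s = f s.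

(* The family [P] stands for the Koszul complex whose term in homological
   degree [c] consists of the chains with values in [P c]: all of [P c = Q] for
   the complex of a submodule [Q], and [P c = Q_(T - c)] for its part of
   degree [T] when [Q] is graded. *)
Definition kex P i := forall f, chain (P i) i f -> (forall s, kd f s = 0) -> kbound P i f.

Lemma kex_ext P Z i : (forall c x, P c x <-> Z c x) -> kex P i -> kex Z i.
Proof.
have sub P1 P2 j f : (forall c x, P1 c x -> P2 c x) -> chain (P1 j) j f -> chain (P2 j) j f.
  by move=> h fC s; move: (fC s); case: ifP => // _ /h.
move=> PZ hP f fZ f0; have [|g [gP gf]] := hP f _ f0.
  by apply: sub fZ => c x; apply: (PZ c x).2.
by exists g; split=> //; apply: sub gP => c x; apply: (PZ c x).1.
Qed.

End Exactness.

Section Monomial.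
Variables (K : fieldType) (n : nat).
Notation S := {mpoly K[n]}.
Implicit Types (s t : {set 'I_n}) (a m : 'X_{1..n}) (f g : {set 'I_n} -> S^o).

Definition sfm s : 'X_{1..n} := [multinom (i \in s : nat) | i < n].

Lemma sfmU1 l s : l \notin s -> sfm (l |: s) = (U_(l) + sfm s)%MM.
Proof.
move=> ls; apply/mnmP => j; rewrite mnmDE !mnmE !inE eq_sym.
by case: eqVneq => [<-|]; rewrite ?(negbTE ls).
Qed.

Lemma mdeg_sfm s : mdeg (sfm s) = #|s|.
Proof.
by rewrite mdegE -sum1_card [RHS]big_mkcond; apply: eq_bigr => i _; rewrite mnmE; case: ifP.
Qed.

Lemma mcoeffXM l (p : S) m :
  ('X_l * p)@_m = if (0 < m l)%N then p@_(m - U_(l)) else 0.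
Proof.
rewrite mulrC; case: ifP => ml.
  rewrite -[in LHS](@submK _ U_(l) m) ?lep1mP -?lt0n // addmC mcoeffMX //.
apply/eqP; rewrite mcoeff_eq0 (perm_mem (msuppMX _ _)); apply/mapP => -[m' _ e].
by move: ml; rewrite e mnmDE mnm1E eqxx.
Qed.

Lemma ksign_mpoly l s : ksign S l s = (ksign K l s)%:MP.
Proof. by rewrite /ksign rmorph_prod; apply: eq_bigr => j _; rewrite rmorphXn rmorphN1. Qed.

Lemma kd_sum f s : kd f s = \sum_(l | l \notin s) ksign K l s *: ('X_l * f (l |: s)).
Proof.
by apply: eq_bigr => l _; rewrite /GRing.scale /= -mulrA ksign_mpoly mul_mpolyC.
Qed.

(** The component in multidegree [a], with $e_s$ placed in multidegree [sfm s]. The guard is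
    essential because subtraction of monomials truncates. *)
Definition mcomp f a s : K := if (sfm s <= a)%MM then (f s)@_(a - sfm s) else 0.

Lemma sfm_leU1 l s a : l \notin s ->
  (sfm (l |: s) <= a)%MM = (sfm s <= a)%MM && (0 < (a - sfm s)%MM l)%N.
Proof.
move=> ls; rewrite sfmU1 //; apply/mnm_lepP/andP => [h|[/mnm_lepP h al] j].
  split; first by apply/mnm_lepP => j; apply: leq_trans (h j); rewrite mnmDE leq_addl.
  by rewrite mnmBE subn_gt0; have := h l; rewrite mnmDE mnm1E eqxx.
rewrite mnmDE mnm1E; case: eqVneq => [<-|_]; last exact: h.
by move: al; rewrite mnmBE subn_gt0.
Qed.

Lemma subm_sfmU1 l s a : l \notin s -> (a - sfm (l |: s) = a - sfm s - U_(l))%MM.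
Proof. by move=> ls; rewrite sfmU1 // submDA addmC. Qed.

Lemma bdry_mcomp f a s : bdry (mcomp f a) s = mcomp (kd f) a s.
Proof.
rewrite /mcomp; case: ifPn => sa; last first.
  by apply: bdry_eq0 => l ls; rewrite sfm_leU1 // (negbTE sa).
rewrite kd_sum raddf_sum /=; apply: eq_bigr => l ls.
by rewrite mcoeffZ mcoeffXM sfm_leU1 // sa subm_sfmU1.
Qed.

Definition msingle (h : {set 'I_n} -> K) a s : S^o := h s *: 'X_[a - sfm s].

Lemma kd_msingle (h : {set 'I_n} -> K) a s :
  (forall t, h t != 0 -> (sfm t <= a)%MM) -> kd (msingle h a) s = msingle (bdry h) a s.
Proof.
move=> ha; rewrite kd_sum /msingle /bdry scaler_suml; apply: eq_bigr => l ls.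
rewrite -scalerAr scalerA; have [->|/ha] := eqVneq (h (l |: s)) 0.
  by rewrite mulr0 !scale0r.
rewrite sfm_leU1 // => /andP[_ al]. 
by rewrite -mpolyXD subm_sfmU1 // addmC submK // lep1mP -lt0n.
Qed.

Lemma mcomp_msingle (h : {set 'I_n} -> K) a s :
  (forall t, h t != 0 -> (sfm t <= a)%MM) -> mcomp (msingle h a) a s = h s.
Proof.
move=> ha; rewrite /mcomp; case: ifPn => sa.
  by rewrite /msingle mcoeffZ mcoeffX eqxx mulr1.
by apply/esym/eqP; apply: contraNT sa => /ha.
Qed.

Variables (B : pred 'X_{1..n}) (D : pred nat).

(** [B] selects the monomials of an ideal and [D] the total degrees, [c] being the degree of $e_s$
    for [#|s| = c]. Thus [D = predT] gives the whole ideal and [D = pred1 T] its strand of degree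
    [T]. *)
Definition mfam c (p : S^o) : Prop := {in msupp p, forall m, B m && D (mdeg m + c)%N}.

Definition mupper a : pred {set 'I_n} := fun s => (sfm s <= a)%MM && B (a - sfm s)%MM.

Lemma mfam0 c : mfam c 0.
Proof. by move=> m; rewrite msupp0. Qed.

Lemma mfamD c p q : mfam c p -> mfam c q -> mfam c (p + q).
Proof.
by move=> hp hq m /msuppD_le; rewrite mem_cat => /orP[/hp|/hq].
Qed.

Lemma mfam_sum (I : Type) (r : seq I) (Q : pred I) (F : I -> S^o) c :
  (forall i, Q i -> mfam c (F i)) -> mfam c (\sum_(i <- r | Q i) F i).
Proof. by move=> h; apply: big_ind => //; [apply: mfam0 | apply: mfamD]. Qed.

Lemma kbound_monomial i f : chain (mfam i) i f ->
  (forall a, exists h : {set 'I_n} -> K,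
    (forall s, h s != 0 -> mupper a s /\ #|s| = i.+1) /\
    forall s, bdry h s = mcomp f a s) ->
  kbound mfam i f.
Proof.
move=> fC /choice_fun[h hP].
have hA a s : h a s != 0 -> (sfm s <= a)%MM by move/(hP a).1 => [/andP[]].
(* Only finitely many multidegrees occur in [f]; the fillings chosen in the others are dropped,
   which keeps the sum finite and in the degrees allowed by [D]. *)
pose L := undup [seq (m + sfm s)%MM | s <- enum {set 'I_n}, m <- msupp (f s)].
have LD a : a \in L -> D (mdeg a).
  rewrite mem_undup => /allpairsPdep[s [m [_ ms ->]]].
  move: (fC s) ms; case: eqP => [si|_ ->]; last by rewrite msupp0.
  by move=> fs /fs /andP[_]; rewrite mdegD mdeg_sfm si.
exists (fun s => \sum_(a <- L) msingle (h a) a s); split => s.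
  case: eqP => [si|si].
    rewrite big_seq; apply: mfam_sum => a aL m.
    rewrite /msingle; have [->|nz] := eqVneq (h a s) 0; first by rewrite scale0r msupp0.
    rewrite (msuppMCX _ nz) inE => /eqP->.
    have [/andP[sa ->] _] := (hP a).1 _ nz.
    by rewrite -si -mdeg_sfm -mdegD submK // LD.
  apply: big1 => a _; rewrite /msingle; suff -> : h a s = 0 by rewrite scale0r.
  by apply/eqP/negPn/negP => /(hP a).1 [_ /si].
rewrite /kd kdiff_sum.
rewrite (eq_bigr (fun a => msingle (bdry (h a)) a s)); last first.
  by move=> a _; apply: (kd_msingle s (hA a)).
apply/mpolyP => m; rewrite raddf_sum /=.
have E a : (msingle (bdry (h a)) a s)@_m = if a == (m + sfm s)%MM then (f s)@_m else 0.
  rewrite /msingle mcoeffZ mcoeffX (hP a).2 /mcomp; case: (eqVneq a (m + sfm s)%MM) => [->|ne].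
    by rewrite lem_addl addmK eqxx mulr1.
  case: ifP => [sa|_]; last by rewrite mul0r.
  case: (eqVneq (a - sfm s)%MM m) => [em|_]; last by rewrite mulr0.
  by move: ne; rewrite -em submK // eqxx.
under eq_bigr => a _ do rewrite E.
have [mf|mf] := boolP (m \in msupp (f s)); last first.
  by rewrite (memN_msupp_eq0 mf) big1 // => a _; case: ifP.
rewrite (bigD1_seq (m + sfm s)%MM) ?undup_uniq //= ?eqxx.
  by rewrite big1 ?addr0 // => a /negbTE->.
by rewrite mem_undup; apply/allpairsPdep; exists s, m; rewrite mem_enum.
Qed.

Lemma mcomp_supp i f a s : chain (mfam i) i f -> mcomp f a s != 0 ->
  [/\ mupper a s, D (mdeg a) & #|s| = i].
Proof.
move=> fC; rewrite /mcomp; case: ifPn => [sa|_]; last by rewrite eqxx.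
rewrite -mcoeff_msupp => ms; move: (fC s); case: eqP => [si h|_ h]; last first.
  by move: ms; rewrite h msupp0.
have /andP[hB hD] := h _ ms; split => //; first by rewrite /mupper sa.
by move: hD; rewrite -si -mdeg_sfm -mdegD submK.
Qed.

Lemma mcomp_cycle f a : (forall s, kd f s = 0) -> forall s, bdry (mcomp f a) s = 0.
Proof. by move=> f0 s; rewrite bdry_mcomp /mcomp f0 mcoeff0; case: ifP. Qed.

Lemma kex_monomial i : (forall a, D (mdeg a) -> exA K (mupper a) i) -> kex mfam i.
Proof.
move=> hA f fC f0; apply: kbound_monomial => // a.
have [Da|Da] := boolP (D (mdeg a)).
  have [|g [gA gf]] := hA a Da (mcomp f a) _ (mcomp_cycle a f0).
    by move=> s /(mcomp_supp fC)[].
  by exists g.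
exists (fun=> 0); split => [s|s]; first by rewrite eqxx.
rewrite bdry_eq0 //; apply/esym/eqP; apply: contraNT Da.
by case/(mcomp_supp fC).
Qed.

Lemma exA_monomial i a : kex mfam i -> D (mdeg a) -> exA K (mupper a) i.
Proof.
move=> hk Da h hA h0.
have hle s : h s != 0 -> (sfm s <= a)%MM by case/hA => /andP[].
have [s|s|g [gC gf]] := hk (msingle h a).
- case: eqP => [si m|si]; last first.
    rewrite /msingle; suff -> : h s = 0 by rewrite scale0r.
    by apply/eqP/negPn/negP => /hA[_ /si].
  rewrite /msingle; have [->|nz] := eqVneq (h s) 0; first by rewrite scale0r msupp0.
  rewrite (msuppMCX _ nz) inE => /eqP->.
  have [/andP[sa ->] _] := hA _ nz.
  by rewrite -si -mdeg_sfm -mdegD submK.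
- by rewrite kd_msingle // /msingle h0 scale0r.
exists (mcomp g a); split => s.
  rewrite /mcomp; case: ifPn => [sa|_]; last by rewrite eqxx.
  rewrite -mcoeff_msupp => ms; move: (gC s); case: eqP => [si hg|_ hg]; last first.
    by move: ms; rewrite hg msupp0.
  by have /andP[hB hD] := hg _ ms; rewrite /mupper sa.
rewrite bdry_mcomp -[RHS](mcomp_msingle s hle) /mcomp.
by rewrite gf.
Qed.

End Monomial.

Section PolynomialRing.
Variables (K : fieldType) (n : nat).
Notation S := {mpoly K[n]}.
Implicit Types (s t U : {set 'I_n}) (a m : 'X_{1..n}) (D : pred nat).

Lemma sfm_le s a : (sfm s <= a)%MM = [forall l in s, 0 < a l]%N.
Proof.
apply/mnm_lepP/forall_inP => h l; first by move=> ls; have := h l; rewrite mnmE ls.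
by rewrite mnmE; case: (boolP (l \in s)) => // ls; apply: h.
Qed.

(** The complex is the full simplex on the support of [a], so any vertex of the support is a cone
    point. For [a = 0] only the empty face is left, which matters at [i = 0] alone. *)
Lemma exA_full a i : (a != 0%MM) || (0 < i)%N -> exA K (mupper predT a) i.
Proof.
have [->|a0] := eqVneq a 0%MM; last first.
  move=> _; have [v av] : exists v, (0 < a v)%N.
    apply/existsP; apply: contraR a0; rewrite negb_exists => /forallP h.
    by apply/eqP/mnmP => l; rewrite mnm0E; apply/eqP; rewrite -leqn0 leqNgt h.
  apply: (exA_cone (v := v)) => s; rewrite /mupper !andbT !sfm_le => /forall_inP h.
  by apply/forall_inP => l; rewrite !inE => /predU1P[->|/h].
rewrite /= => i0 f fA f0; exists (fun=> 0); split => s; first by rewrite eqxx.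
rewrite bdry_eq0 //; apply/esym/eqP/negPn/negP => /fA[].
rewrite /mupper sfm_le andbT => /forall_inP h si.
move: i0; rewrite -si card_gt0 => /set0Pn[l /h]; by rewrite mnm0E.
Qed.

Lemma kex_mpoly D i : kex (mfam predT D : nat -> S^o -> Prop) i.+1.
Proof. by apply: kex_monomial => a _; apply: exA_full; rewrite orbT. Qed.

Lemma kd_set0 (M : lmodType S) (g : {set 'I_n} -> M) :
  kd g set0 = \sum_l 'X_l *: g [set l].
Proof.
apply: eq_big => [l|l _]; first by rewrite inE.
by rewrite ksign0 mul1r setU0.
Qed.

(** In position 0 the Koszul homology of the polynomial ring sits in multidegree 0, where the
    missing constant coefficient disposes of it. *)
Lemma mfam_const0 D (p : S^o) : mfam predT D 0 p -> p@_0%MM = 0 ->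
  exists q : 'I_n -> S^o, (forall l, mfam predT D 1 (q l)) /\ p = \sum_l 'X_l *: q l.
Proof.
move=> pD p0; pose f s : S^o := if s == set0 then p else 0.
have fC : chain (mfam predT D 0) 0 f.
  by move=> s; rewrite cards_eq0 /f; case: (s == set0).
have f0 s : kd f s = 0.
  apply: kdiff_eq0 => l _; rewrite /f; case: eqP => // /setP/(_ l).
  by rewrite !inE eqxx.
have [a|g [gC gf]] := kbound_monomial fC.
  have [->|a0] := eqVneq a 0%MM.
    exists (fun=> 0); split => [s|s]; first by rewrite eqxx.
    rewrite bdry_eq0 // /mcomp; case: ifP => // s0.
    rewrite /f; case: eqP => [->|_]; last by rewrite mcoeff0.
    by rewrite sub0m p0.
  have ha : (a != 0%MM) || (0 < 0)%N by rewrite a0.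
  have [||g [gA gf]] := exA_full ha (f := mcomp f a).
  - by move=> s /(mcomp_supp fC)[].
  - exact: mcomp_cycle.
  - by exists g.
exists (fun l => g [set l]); split => [l|]; first by have := gC [set l]; rewrite cards1.
by rewrite -kd_set0 gf /f eqxx.
Qed.

End PolynomialRing.

(** * Koszul homology of the edge ideal *)

Section EdgeIdeal.
Variables (K : fieldType) (n : nat) (e : rel 'I_n).
Hypotheses (e_sym : ssrbool.symmetric e) (e_irr : irreflexive e).
Notation S := {mpoly K[n]}.
Implicit Types (s t U : {set 'I_n}) (a m : 'X_{1..n}) (D : pred nat).

Definition edge_mnm : pred 'X_{1..n} :=
  fun m => [exists i, exists j, [&& e i j, 0 < m i & 0 < m j]]%N.

Lemma edge_mnmP m : reflect (exists i j, [/\ e i j, (0 < m i)%N & (0 < m j)%N]) (edge_mnm m).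
Proof.
apply: (iffP existsP) => [[i /existsP[j /and3P[]]]|[i [j [eij mi mj]]]].
  by exists i, j.
by exists i; apply/existsP; exists j; rewrite eij mi mj.
Qed.

Lemma edge_idealP (p : S) : edge_ideal e p <-> {in msupp p, forall m, edge_mnm m}.
Proof.
split=> [[r [c [g [gE ->]]]] m|h].
  move=> /msupp_sum_le/flattenP[_ /mapP[k _ ->]].
  have [i [j [eij ->]]] := gE k; rewrite -mpolyXD (perm_mem (msuppMX _ _)).
  case/mapP => m' _ ->; apply/edge_mnmP; exists i, j; split => //.
    by rewrite !mnmDE mnm1E eqxx.
  by rewrite !mnmDE !mnm1E eqxx addnAC addnC.
pose J : S -> Prop := @edge_ideal K n e.
have J0 : J 0 by exists 0%N, (fun=> 0), (fun=> 0); split => [[]//|]; rewrite big_ord0.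
have JD p1 p2 : J p1 -> J p2 -> J (p1 + p2).
  move=> [r1 [c1 [g1 [h1 ->]]]] [r2 [c2 [g2 [h2 ->]]]].
  exists (r1 + r2)%N, (fun k => match split k with inl a => c1 a | inr a => c2 a end),
    (fun k => match split k with inl a => g1 a | inr a => g2 a end); split.
    by move=> k; case: split.
  rewrite big_split_ord /=; congr (_ + _); apply: eq_bigr => k _.
    by rewrite -[lshift _ _]/(unsplit (inl k)) unsplitK.
  by rewrite -[rshift _ _]/(unsplit (inr k)) unsplitK.
rewrite [p]mpolyE big_seq; apply: (big_ind J) => // m /h /edge_mnmP[i [j [eij mi mj]]].
have ij : i != j by apply: contraTneq eij => ->; rewrite e_irr.
exists 1%N, (fun=> p@_m *: 'X_[m - (U_(i) + U_(j))]), (fun=> 'X_i * 'X_j); split.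
  by move=> _; exists i, j.
rewrite big_ord1 -scalerAl -!mpolyXD submK //; apply/mnm_lepP => l.
rewrite mnmDE !mnm1E; case: eqVneq => [<-|_]; first by rewrite eq_sym (negbTE ij).
by case: eqVneq => [<-|].
Qed.

Lemma exA_ext (A1 A2 : pred {set 'I_n}) i : A1 =1 A2 -> exA K A1 i -> exA K A2 i.
Proof.
move=> A12 h f fA f0; have [|g [gA gf]] := h f _ f0.
  by move=> s /fA; rewrite A12.
by exists g; split => // s /gA; rewrite A12.
Qed.

Lemma mupper_sfm U : mupper edge_mnm (sfm U) =1 upper e U.
Proof.
move=> s; rewrite /mupper /upper sfm_le.
have -> : [forall l in s, 0 < sfm U l]%N = (s \subset U).
  by apply/forall_inP/subsetP => h l /h; rewrite mnmE; case: (l \in U).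
congr (_ && _); apply/edge_mnmP/negP => [[i [j [eij]]]|h].
  have in_diff l : (0 < (sfm U - sfm s)%MM l)%N -> l \in U :\: s.
    by rewrite mnmBE !mnmE inE; case: (l \in U); case: (l \in s).
  by move=> /in_diff i_in /in_diff j_in /stableP/(_ i j i_in j_in); rewrite eij.
apply: NNPP => hn; apply: h; apply/stableP => i j iU jU; apply/negP => eij; apply: hn.
exists i, j; split => //.
  by move: iU; rewrite mnmBE !mnmE inE; case: (i \in U); case: (i \in s).
by move: jU; rewrite mnmBE !mnmE inE; case: (j \in U); case: (j \in s).
Qed.

(* The Koszul homology of a squarefree monomial ideal lives in squarefree
   multidegrees: if [a v >= 2], then [v] is a cone point. *)
Lemma exA_edge i a : (forall U, mdeg a = #|U| -> exA K (upper e U) i) ->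
  exA K (mupper edge_mnm a) i.
Proof.
move=> h; have [v av|sq] := pickP (fun v => 1 < a v)%N.
  apply: (exA_cone (v := v)) => s; have [vs|vs] := boolP (v \in s).
    by rewrite setUC (setUidPl _) ?sub1set.
  have av' : ((a - sfm s)%MM v = a v) by rewrite mnmBE mnmE (negbTE vs) subn0.
  rewrite /mupper sfm_leU1 // => /andP[-> /edge_mnmP[i1 [i2 [ei h1 h2]]]].
  rewrite av' (ltnW av) /= subm_sfmU1 //; apply/edge_mnmP.
  have pos l : (0 < (a - sfm s)%MM l -> 0 < (a - sfm s - U_(v))%MM l)%N.
    rewrite [in X in _ -> X]mnmBE mnm1E; case: eqVneq => [<-|]; last by rewrite subn0.
    by rewrite av' subn_gt0.
  by exists i1, i2; split => //; apply: pos.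
pose U := [set v | a v == 1%N].
have aU : a = sfm U.
  by apply/mnmP => l; rewrite mnmE inE; have := sq l; case: (a l) => [|[]].
rewrite aU; apply: (exA_ext (fsym (mupper_sfm U))); apply: h.
by rewrite aU mdeg_sfm.
Qed.

Lemma exA_upper_small U i : (#|U| <= i)%N -> exA K (upper e U) i.
Proof.
move=> Ui f fA f0; exists (fun=> 0); split => s; first by rewrite eqxx.
rewrite bdry_eq0 //; apply/esym/eqP/negPn/negP => /fA[/andP[sU ns] si].
have e0 : U :\: s = set0.
  apply/eqP; rewrite setD_eq0 -(subset_leqif_card sU).2.
  by rewrite eqn_leq subset_leq_card // si.
by move: ns; rewrite e0 => /negP; apply; apply/stableP => j l; rewrite inE.
Qed.

(* Hochster's formula: [Tor_i] in the squarefree multidegree [U] is the reduced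
   cohomology of the independence complex on [U] in dimension [#|U| - i - 2]. *)
Lemma kex_edgeP D i : kex (mfam edge_mnm D : nat -> S^o -> Prop) i <->
  forall U k, #|U| = (k + i.+1)%N -> D #|U| -> exC K e U k.
Proof.
split=> [h U k Uk DU|h].
  apply/(exA_exC K e Uk); apply: (exA_ext (mupper_sfm U)).
  by apply: exA_monomial h _; rewrite mdeg_sfm.
apply: kex_monomial => a Da; apply: exA_edge => U aU.
have [Ui|iU] := leqP #|U| i; first exact: exA_upper_small.
have Uk : #|U| = (#|U| - i.+1 + i.+1)%N by rewrite subnK.
by apply/(exA_exC K e Uk); apply: h => //; rewrite -aU.
Qed.

End EdgeIdeal.

(** * Dimension shifting *)

Section Families.
Variables (K : fieldType) (n : nat) (M : lmodType {mpoly K[n]}).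
Implicit Types (P Z : nat -> M -> Prop) (f g : {set 'I_n} -> M) (s t : {set 'I_n}).

(** The Koszul differential needs no more than multiplication by variables with a shift of position;
    closure under all scalars would exclude strands of a single degree. *)
Definition kfamily P := [/\ forall c, P c 0,
  forall c x y, P c x -> P c y -> P c (x - y) &
  forall c l x, P c.+1 x -> P c ('X_l *: x)].

Lemma kfamilyN P c x : kfamily P -> P c x -> P c (- x).
Proof. by case=> P0 PB _ Px; rewrite -sub0r; apply: PB. Qed.

Lemma kfamilyD P c x y : kfamily P -> P c x -> P c y -> P c (x + y).
Proof.
move=> PF Px Py; rewrite -[y]opprK; case: (PF) => _ PB _.
by apply: PB => //; apply: kfamilyN.
Qed.

Lemma kfamily_sum P c (I : Type) (r : seq I) (Q : pred I) (F : I -> M) : kfamily P ->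
  (forall i, Q i -> P c (F i)) -> P c (\sum_(i <- r | Q i) F i).
Proof.
move=> PF h; apply: big_ind => //; first by case: PF.
by move=> *; apply: kfamilyD.
Qed.

Lemma kfamily_ksign P c l s x : kfamily P -> P c x -> P c (ksign {mpoly K[n]} l s *: x).
Proof.
move=> PF Px; have [->|->] : ksign {mpoly K[n]} l s = 1 \/ ksign {mpoly K[n]} l s = -1.
- apply: (big_ind (fun a => a = 1 \/ a = -1)); first by left.
    by move=> a b [->|->] [->|->]; rewrite ?mul1r ?mulN1r ?opprK; [left|right|right|left].
  by move=> j _; case: (_ < _)%N; [right | left].
- by rewrite scale1r.
by rewrite scaleN1r; apply: kfamilyN.
Qed.

Lemma chain_kd P i g : kfamily P -> chain (P i.+1) i.+1 g -> chain (P i) i (kd g).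
Proof.
move=> PF gC s; have cU l : l \notin s -> #|l |: s| = #|s|.+1 by rewrite cardsU1 => ->.
case: eqP => [si|/eqP si].
  apply: kfamily_sum => // l ls; rewrite -scalerA; apply: kfamily_ksign => //.
  case: (PF) => _ _; apply; have := gC (l |: s).
  by rewrite cU // si eqxx.
apply: kdiff_eq0 => l ls; have := gC (l |: s).
by rewrite cU // eqSS (negbTE si).
Qed.

Lemma chainB P i f g : kfamily P -> chain (P i) i f -> chain (P i) i g ->
  chain (P i) i (fun s => f s - g s).
Proof.
move=> [_ PB _] hf hg s; have := hf s; have := hg s; case: eqP => _; last by move=> -> ->; rewrite subr0.
by move=> *; apply: PB.
Qed.

Lemma chain_sub P Z i f : (forall x, P i x -> Z i x) -> chain (P i) i f -> chain (Z i) i f.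
Proof. by move=> PZ fC s; have := fC s; case: eqP => // _ /PZ. Qed.

Definition kin P x := exists p : 'I_n -> M, (forall l, P 1%N (p l)) /\ x = \sum_l 'X_l *: p l.

Lemma kbound0P P Z f : kfamily P -> chain (Z 0%N) 0 f -> kbound P 0 f <-> kin P (f set0).
Proof.
move=> PF fC; split=> [[g [gC gf]]|[p [pP pf]]].
  exists (fun l => g [set l]); rewrite -kd_set0 gf; split => // l.
  by have := gC [set l]; rewrite cards1.
pose g s := if #|s| == 1%N then \sum_(l in s) p l else 0.
have g1 l : g [set l] = p l by rewrite /g cards1 eqxx big_set1.
exists g; split => s.
  rewrite /g; case: eqP => // _; apply: kfamily_sum => // l _; exact: pP.
have := fC s; rewrite cards_eq0; case: eqP => [-> _|/eqP s0 ->].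
  by rewrite kd_set0 pf; apply: eq_bigr => l _; rewrite g1.
apply: kdiff_eq0 => l ls; rewrite /g cardsU1 ls /= add1n eqSS cards_eq0 (negbTE s0) //.
Qed.

Lemma kex0P P : kfamily P -> kex P 0 <-> forall x, P 0%N x -> kin P x.
Proof.
move=> PF; split=> [h x Px|h f fC f0].
  pose f s := if s == set0 then x else 0.
  have fC : chain (P 0%N) 0 f by move=> s; rewrite cards_eq0 /f; case: (s == set0).
  have -> : x = f set0 by rewrite /f eqxx.
  rewrite -(kbound0P PF fC); apply: h => // s; apply: kdiff_eq0 => l ls.
  by rewrite /f; case: eqP => // /setP/(_ l); rewrite !inE eqxx.
rewrite (kbound0P PF fC); apply: h; have := fC set0; by rewrite cards0.
Qed.

(* The map from the Koszul homology of [Z] to that of [P] is injective. *)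
Definition kinj P Z i := forall f, chain (Z i) i f -> kbound P i f -> kbound Z i f.

Lemma kinj0P P Z : kfamily P -> kfamily Z ->
  kinj P Z 0 <-> forall x, Z 0%N x -> kin P x -> kin Z x.
Proof.
move=> PF ZF; split=> [h x Zx xP|h f fC].
  pose f s := if s == set0 then x else 0.
  have fC : chain (Z 0%N) 0 f by move=> s; rewrite cards_eq0 /f; case: (s == set0).
  have e : x = f set0 by rewrite /f eqxx.
  rewrite e -(kbound0P ZF fC); apply: h => //; rewrite (kbound0P PF fC).
  by rewrite -e.
rewrite (kbound0P PF fC) (kbound0P ZF fC) => hp; apply: h => //.
by have := fC set0; rewrite cards0.
Qed.

Lemma kinj_kex P Z i : (forall c x, Z c x -> P c x) -> kex P i ->
  kinj P Z i <-> kex Z i.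
Proof.
move=> ZP hP; split=> h f fC.
  by move=> f0; apply: h => //; apply: hP => //; apply: chain_sub fC => x /ZP.
move=> [g [_ gf]]; apply: h => // s.
rewrite -[RHS](kdiff_kdiff (fun k => 'X_k) g s); apply: eq_kdiff => l _.
by rewrite -gf.
Qed.

Lemma kinj_ext P Z Z' i : (forall c x, Z c x <-> Z' c x) -> kinj P Z i -> kinj P Z' i.
Proof.
move=> ZZ h f fC fP; have [|g [gC gf]] := h f _ fP.
  by apply: (chain_sub (P := Z')) fC => x /ZZ.
by exists g; split => //; apply: (chain_sub (P := Z)) gC => x /ZZ.
Qed.

End Families.

Section Shift.
Variables (K : fieldType) (n : nat) (M N : lmodType {mpoly K[n]}).
Variables (pi : {linear M -> N}) (P : nat -> M -> Prop).
Hypothesis PF : kfamily P.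
Implicit Types (f g : {set 'I_n} -> M) (s t : {set 'I_n}).

Definition kerfam c x := P c x /\ pi x = 0.
Definition imfam c y := exists2 x, P c x & pi x = y.

Lemma kerfamF : kfamily kerfam.
Proof.
case: PF => P0 PB PX; split=> [c|c x y [Px x0] [Py y0]|c l x [Px x0]].
- by split; rewrite ?linear0.
- by split; [apply: PB | rewrite linearB x0 y0 subr0].
- by split; [apply: PX | rewrite linearZ /= x0 scaler0].
Qed.

Lemma imfamF : kfamily imfam.
Proof.
case: PF => P0 PB PX; split=> [c|c x y [x' Px <-] [y' Py <-]|c l x [x' Px <-]].
- by exists 0; rewrite ?linear0.
- by exists (x' - y'); [apply: PB | rewrite linearB].
- by exists ('X_l *: x'); [apply: PX | rewrite linearZ].
Qed.

Lemma kd_linear f s : kd (fun t => pi (f t)) s = pi (kd f s).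
Proof. by rewrite /kd /kdiff linear_sum; apply: eq_bigr => l _; rewrite linearZ. Qed.

Lemma kdB (L : lmodType {mpoly K[n]}) (f g : {set 'I_n} -> L) s :
  kd (fun t => f t - g t) s = kd f s - kd g s.
Proof. exact: kdiffB. Qed.

Lemma kd_kd (L : lmodType {mpoly K[n]}) (f : {set 'I_n} -> L) s : kd (kd f) s = 0.
Proof. exact: kdiff_kdiff. Qed.

Lemma chain_lift i (h : {set 'I_n} -> N) : chain (imfam i) i h ->
  exists2 q, chain (P i) i q & forall s, pi (q s) = h s.
Proof.
move=> hC.
have /choice_fun[q qP] : forall s, exists x, (if #|s| == i then P i x else x = 0) /\ pi x = h s.
  move=> s; have := hC s; case: eqP => _; first by case=> x Px <-; exists x.
  by move=> ->; exists 0; rewrite linear0.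
by exists q => s; case: (qP s).
Qed.

Lemma chain_im i f : chain (P i) i f -> chain (imfam i) i (fun s => pi (f s)).
Proof.
move=> fC s; have := fC s; case: eqP => _; last by move=> ->; rewrite linear0.
by exists (f s).
Qed.

(** By the long exact sequence of kernel, family and image, a class of the kernel that dies in [P]
    comes from the homology of the image one degree up. *)
Lemma kex_im_kinj i : kex imfam i.+1 -> kinj P kerfam i.
Proof.
move=> h f fC [g [gC gf]].
have fZ s : pi (f s) = 0.
  by have := fC s; case: eqP => [_ []|_ ->] //; rewrite linear0.
have [|s|q' [q'C q'g]] := h (fun s => pi (g s)); first exact: chain_im.
  by rewrite kd_linear gf fZ.
have [q qC qq'] := chain_lift q'C.
exists (fun s => g s - kd q s); split => s; last by rewrite kdB kd_kd subr0 gf.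
have := chainB PF gC (chain_kd PF qC) s; case: eqP => // _ hP; split => //.
rewrite linearB -kd_linear -q'g; apply/eqP; rewrite subr_eq0; apply/eqP/eq_kdiff => l _.
by rewrite qq'.
Qed.

(** Exactness of [P] makes the connecting map out of the homology of the image injective; [kinj]
    makes it zero. *)
Lemma kinj_kex_im i : kex P i.+1 -> kinj P kerfam i -> kex imfam i.+1.
Proof.
move=> hP hZ y yC y0; have [p pC py] := chain_lift yC.
have pi0 s : pi (kd p s) = 0.
  by rewrite -kd_linear -(y0 s); apply: eq_kdiff => l _.
have [s||z [zC zp]] := hZ (kd p).
  have := chain_kd PF pC s; case: eqP => // _ h; split => //.
  by exists p.
have zC' : chain (P i.+1) i.+1 z by apply: (chain_sub (P := kerfam)) zC => x [].
have [s|q [qC qp]] := hP _ (chainB PF pC zC'); first by rewrite kdB zp subrr.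
exists (fun s => pi (q s)); split; first exact: chain_im.
move=> s; rewrite kd_linear qp linearB py; have := zC s; case: eqP => _.
  by case=> _ ->; rewrite subr0.
by move=> ->; rewrite linear0 subr0.
Qed.

End Shift.

Section Resolution.
Variables (K : fieldType) (n : nat) (N : lmodType {mpoly K[n]}).
Variables (E : nat -> lmodType {mpoly K[n]}) (aug : {linear E 0 -> N}).
Variables (d : forall i, {linear E i.+1 -> E i}) (P : forall i, nat -> E i -> Prop).
Hypotheses (PF : forall i, kfamily (@P i)) (Pex : forall i j, kex (@P i) j.+1).
Hypothesis aug0 : forall c x, P c x /\ aug x = 0 <-> imfam (d 0) (@P 1) c x.
Hypothesis d0 : forall i c x, P c x /\ d i x = 0 <-> imfam (d i.+1) (@P i.+2) c x.

(** Iterated dimension shifting. It ends with injectivity in position 0, since the [P i] are exact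
    in positive positions only. *)
Lemma kex_resolution i :
  kex (imfam aug (@P 0)) i.+1 <-> kinj (@P i) (imfam (d i) (@P i.+1)) 0.
Proof.
have sub k c x : imfam (d k) (@P k.+1) c x -> P c x.
  by case: k x => [|k] x; [move/aug0 => [] | move/d0 => []].
suff H k j : kex (imfam aug (@P 0)) (k + j).+1 <-> kinj (@P k) (imfam (d k) (@P k.+1)) j.
  by have := H i 0%N; rewrite addn0.
elim: k j => [|k IH] j.
  split=> [h|h]; first exact: kinj_ext aug0 (kex_im_kinj (PF 0) h).
  apply: kinj_kex_im => //; apply: kinj_ext h => c x; symmetry; exact: aug0.
rewrite addSnnS IH (kinj_kex (sub k) (@Pex k j)); split=> h.
  exact: kinj_ext (@d0 k) (kex_im_kinj (PF _) h).
apply: kinj_kex_im => //; apply: kinj_ext h => c x; symmetry; exact: d0.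
Qed.

End Resolution.

(** * Graded free and projective modules *)

Section MonomialProjection.
Variables (K : fieldType) (n : nat).
Notation S := {mpoly K[n]}.
Implicit Types (p q : S) (m : 'X_{1..n}) (Q : pred 'X_{1..n}).

Definition mproj Q p : S := \sum_(m <- msupp p | Q m) p@_m *: 'X_[m].

Lemma mcoeff_mproj Q p m : (mproj Q p)@_m = if Q m then p@_m else 0.
Proof.
rewrite raddf_sum /= -big_filter; have [mp|mp] := boolP (m \in msupp p); last first.
  rewrite (memN_msupp_eq0 mp) if_same big_filter big_seq_cond big1 // => m' /andP[hm' _].
  rewrite mcoeffZ mcoeffX; case: eqP hm' mp => [->->//|_ _ _]; exact: mulr0.
rewrite big_filter big_mkcond (bigD1_seq m) ?msupp_uniq //= big1 ?addr0.
  by case: ifP => // _; rewrite mcoeffZ mcoeffX eqxx mulr1.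
by move=> m' /negbTE mm; case: ifP => // _; rewrite mcoeffZ mcoeffX mm mulr0.
Qed.

Lemma mproj_id Q p : {in msupp p, forall m, Q m} -> mproj Q p = p.
Proof.
move=> h; apply/mpolyP => m; rewrite mcoeff_mproj; case: ifPn => // Qm.
by apply/esym/eqP; rewrite mcoeff_eq0; apply: contra Qm => /h.
Qed.

Lemma mprojM Q Q' p q : (forall m m', m' \in msupp q -> Q (m + m')%MM = Q' m) ->
  mproj Q (p * q) = mproj Q' p * q.
Proof.
move=> h; have -> : p = mproj Q' p + mproj (predC Q') p.
  by apply/mpolyP => m; rewrite mcoeffD !mcoeff_mproj /=; case: (Q' m); rewrite ?addr0 ?add0r.
set p1 := mproj Q' p; set p2 := mproj _ p.
have p1Q m : m \in msupp p1 -> Q' m.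
  by rewrite mcoeff_msupp mcoeff_mproj; case: ifP; rewrite ?eqxx.
have p2Q m : m \in msupp p2 -> ~~ Q' m.
  by rewrite mcoeff_msupp mcoeff_mproj /=; case: (Q' m); rewrite ?eqxx.
rewrite mulrDl; apply/mpolyP => m; rewrite mcoeff_mproj mcoeffD.
have -> : mproj Q' (p1 + p2) = p1.
  apply/mpolyP => m'; rewrite mcoeff_mproj mcoeffD /p1 /p2 !mcoeff_mproj /=.
  by case: (Q' m'); rewrite ?addr0.
have in1 : (p1 * q)@_m != 0 -> Q m.
  rewrite -mcoeff_msupp => /msuppM_le/allpairsP[[m1 m2] /= [h1 h2 ->]].
  by rewrite h // p1Q.
have in2 : (p2 * q)@_m != 0 -> ~~ Q m.
  rewrite -mcoeff_msupp => /msuppM_le/allpairsP[[m1 m2] /= [h1 h2 ->]].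
  by rewrite h // p2Q.
case: ifPn => Qm.
  have -> : (p2 * q)@_m = 0 by apply/eqP; apply: contraTT Qm.
  by rewrite addr0.
by apply/esym/eqP; apply: contraNT Qm.
Qed.

End MonomialProjection.

Lemma kd_morph (K : fieldType) (n : nat) (M N : lmodType {mpoly K[n]}) (h : M -> N)
    (f : {set 'I_n} -> M) s :
  {morph h : x y / x + y} -> h 0 = 0 -> (forall c x, h (c *: x) = c *: h x) ->
  kd (fun t => h (f t)) s = h (kd f s).
Proof.
move=> hD h0 hZ; rewrite /kd /kdiff (big_morph h hD h0).
by apply: eq_bigr => l _; rewrite hZ.
Qed.

Section GradedRows.
Variables (K : fieldType) (n : nat) (D : pred nat).
Notation S := {mpoly K[n]}.

(* Row vectors whose coordinate along the [k]-th basis element, of degree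
   [deg k], only has monomials [m] such that [m] times that basis element has
   a degree [t] with [D (t + c)]. *)
Definition hfam r (deg : 'I_r -> nat) c (v : 'rV[S]_r) : Prop :=
  forall k, mfam predT (fun t => D (t + deg k)%N) c (v 0 k : S^o).

Definition hproj r (deg : 'I_r -> nat) c (v : 'rV[S]_r) : 'rV[S]_r :=
  \row_k mproj (fun m => D (mdeg m + c + deg k)%N) (v 0 k).

Definition homog_mx r r' (deg : 'I_r -> nat) (deg' : 'I_r' -> nat) (A : 'M[S]_(r, r')) :=
  forall k l m, m \in msupp (A k l) -> (mdeg m + deg' l)%N = deg k.

Lemma mfam_predTF (D' : pred nat) : kfamily (mfam predT D' : nat -> S^o -> Prop).
Proof.
split=> [c m|c x y hx hy m|c l x hx m]; first by rewrite msupp0.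
  by move=> /msuppB_le; rewrite mem_cat => /orP[/hx|/hy].
rewrite [_ *: _]mulrC (perm_mem (msuppMX _ _)) => /mapP[m' /hx h ->].
by rewrite mdegD mdeg1 add1n addSnnS.
Qed.

Lemma hfam_hproj r (deg : 'I_r -> nat) c v : hfam deg c (hproj deg c v).
Proof.
move=> k m; rewrite mxE mcoeff_msupp mcoeff_mproj; case: ifP => //.
by rewrite eqxx.
Qed.

Variables (r : nat) (deg : 'I_r -> nat).
Implicit Types v : 'rV[S]_r.

Lemma hfamF : kfamily (hfam deg).
Proof.
split=> [c k|c x y hx hy k|c l x hx k]; have [h0 hB hX] := mfam_predTF (fun t => D (t + deg k)%N).
- by rewrite mxE.
- by rewrite !mxE; apply: hB.
- by rewrite mxE; apply: hX.
Qed.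

Lemma hproj_id c v : hfam deg c v -> hproj deg c v = v.
Proof. by move=> h; apply/rowP => k; rewrite mxE mproj_id // => m /h. Qed.

Lemma mprojD Q (p q : S) : mproj Q (p + q) = mproj Q p + mproj Q q.
Proof. by apply/mpolyP => m; rewrite mcoeffD !mcoeff_mproj mcoeffD; case: ifP; rewrite ?addr0. Qed.

Lemma mproj0 Q : mproj Q (0 : S) = 0.
Proof. by apply/mpolyP => m; rewrite mcoeff_mproj mcoeff0 if_same. Qed.

(** This is what lets a preimage of a graded element under a homogeneous matrix be replaced by its
    graded part. *)
Lemma hproj_mul r' (deg' : 'I_r' -> nat) (A : 'M_(r, r')) c v :
  homog_mx deg deg' A -> hproj deg' c (v *m A) = hproj deg c v *m A.
Proof.
move=> hA; apply/rowP => l; rewrite !mxE.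
rewrite (big_morph _ (mprojD _) (mproj0 _)); apply: eq_bigr => k _.
rewrite mxE; apply: mprojM => m m' /hA <-; rewrite mdegD; congr D.
by rewrite -!addnA; congr addn; rewrite addnCA.
Qed.

Lemma hfam_mul r' (deg' : 'I_r' -> nat) (A : 'M_(r, r')) c v :
  homog_mx deg deg' A -> hfam deg c v -> hfam deg' c (v *m A).
Proof. by move=> hA /hproj_id <-; rewrite -(hproj_mul c v hA); apply: hfam_hproj. Qed.

Lemma kd_row (f : {set 'I_n} -> 'rV[S]_r) k s :
  kd (fun t => f t 0 k : S^o) s = kd f s 0 k.
Proof.
apply: (kd_morph (h := fun v : 'rV[S]_r => v 0 k : S^o)); try by move=> *; rewrite mxE.
Qed.

Lemma kex_rows i : kex (hfam deg) i.+1.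
Proof.
move=> f fC f0.
have /choice_fun[g gP] : forall k : 'I_r, exists g : {set 'I_n} -> S^o,
    chain (mfam predT (fun t => D (t + deg k)%N) i.+2) i.+2 g /\ forall s, kd g s = f s 0 k.
  move=> k; have [s|s|g gP] := @kex_mpoly K n (fun t => D (t + deg k)%N) i (fun s => f s 0 k).
  - by have := fC s; case: eqP => [_|_ ->]; rewrite ?mxE // => /(_ k).
  - by rewrite kd_row f0 mxE.
  by exists g.
exists (fun s => \row_k g k s); split=> s.
  have gC k : if #|s| == i.+2 then _ else _ := (gP k).1 s.
  case: eqP gC => _ gC; first by move=> k; rewrite mxE; apply: gC.
  by apply/rowP => k; rewrite !mxE gC.
apply/rowP => k; rewrite -(gP k).2 -kd_row.
by apply: (eq_kdiff (M := S^o)) => l _; rewrite mxE.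
Qed.

(** Together with [kin_const0], this reads the quotient of a free module by the maximal ideal off
    the constant coefficients. *)
Lemma hfam_const0 v : hfam deg 0 v -> (forall k, (v 0 k)@_0%MM = 0) -> kin (hfam deg) v.
Proof.
move=> hv v0.
have /choice_fun[q qP] : forall k, exists q : 'I_n -> S^o,
    (forall l, mfam predT (fun t => D (t + deg k)%N) 1 (q l)) /\ v 0 k = \sum_l 'X_l *: q l.
  by move=> k; apply: mfam_const0; [apply: hv | apply: v0].
exists (fun l => \row_k q k l); split=> [l k|]; first by rewrite mxE; case: (qP k).
apply/rowP => k; rewrite (qP k).2 summxE; apply: eq_bigr => l _.
by rewrite !mxE.
Qed.

Lemma kin_const0 v : kin (hfam deg) v -> forall k, (v 0 k)@_0%MM = 0.
Proof.
move=> [p [_ ->]] k; rewrite summxE raddf_sum /= big1 // => l _.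
by rewrite mxE mcoeffXM mnm0E.
Qed.

End GradedRows.

(** * Koszul homology bounds the length of ungraded projective resolutions *)

Section Projective.
Variables (K : fieldType) (n : nat).
Notation S := {mpoly K[n]}.

Definition allfam (M : lmodType S) (c : nat) (x : M) : Prop := True.

Lemma allfamF M : kfamily (@allfam M).
Proof. by []. Qed.

Lemma kex_allS i : kex (@allfam S^o) i.+1.
Proof.
by apply: kex_ext (@kex_mpoly K n predT i) => c x; split.
Qed.

Lemma kd_coeff (A : choiceType) (f : {set 'I_n} -> {freeg A / S}) x s :
  kd (fun t => coeff x (f t) : S^o) s = coeff x (kd f s).
Proof.
apply: (kd_morph (h := fun w : {freeg A / S} => coeff x w : S^o)).
- exact: coeffD.
- exact: coeff0.
by move=> c w; rewrite coeffZ.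
Qed.

Lemma kex_freeg (A : choiceType) i : kex (@allfam {freeg A / S}) i.+1.
Proof.
move=> f fC f0.
have /choice_fun[g gP] : forall x : A, exists g : {set 'I_n} -> S^o,
    chain (@allfam S^o i.+2) i.+2 g /\ forall s, kd g s = coeff x (f s).
  move=> x; have [s|s|g gP] := @kex_allS i (fun s => coeff x (f s)).
  - by have := fC s; case: eqP => // _ ->; rewrite coeff0.
  - by rewrite kd_coeff f0 coeff0.
  by exists g.
(* Only basis elements occurring in [f] are kept; otherwise the coordinatewise fillings need not
   have finite support. *)
pose L := undup (flatten [seq dom (f s) | s <- enum {set 'I_n}]).
have gL x s : coeff x (\sum_(y <- L) << (g y s : S) *g y >>) = if x \in L then g x s else 0.
  rewrite raddf_sum /=; under eq_bigr => y _ do rewrite coeffU.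
  case: ifPn => xL; last first.
    rewrite big_seq big1 // => y yL; case: eqP yL xL => [->->//|_ _ _]; exact: mulr0.
  rewrite (bigD1_seq x) ?undup_uniq //= eqxx mulr1 big1 ?addr0 // => y /negbTE->.
  by rewrite mulr0.
exists (fun s => \sum_(x <- L) << (g x s : S) *g x >>); split=> s.
  case: eqP => // si; rewrite big1 // => x _; have := (gP x).1 s.
  by case: eqP => // _ ->; rewrite freegU0.
apply/eqP/freeg_eqP => x; rewrite -kd_coeff.
have [xL|xL] := boolP (x \in L).
  by rewrite -(gP x).2; apply: (eq_kdiff (M := S^o)) => l _; rewrite gL xL.
rewrite coeff_outdom; first by apply: (kdiff_eq0 (M := S^o)) => l _; rewrite gL (negbTE xL).
apply: contra xL => xs; rewrite mem_undup; apply/flattenP; exists (dom (f s)) => //.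
by apply: map_f; rewrite mem_enum.
Qed.

HB.instance Definition _ (M : lmodType S) (A : choiceType) (h : A -> M) :=
  GRing.isZmodMorphism.Build {freeg A / S} M (fglift h) (lift_is_additive h).

Lemma fgliftZ (M : lmodType S) (A : choiceType) (h : A -> M) (c : S) (w : {freeg A / S}) :
  fglift h (c *: w) = c *: fglift h w.
Proof.
have e (b : S) (v : {freeg A / S}) : fglift h (b *: v) = \sum_(x <- dom v) (b * coeff x v) *: h x.
  rewrite [b *: v](_ : _ = \sum_(x <- dom v) << b * coeff x v *g x >>) //.
  by rewrite raddf_sum; apply: eq_bigr => x _; exact: liftU.
rewrite e -[in RHS](scale1r w) e scaler_sumr; apply: eq_bigr => x _.
by rewrite mul1r scalerA.
Qed.

(** A projective module is a retract of the free module on its own elements, where cycles can be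
    filled and mapped back. *)
Lemma kex_projective (M : lmodType S) i : projective M -> kex (@allfam M) i.+1.
Proof.
pose pi := fglift (id : M -> M).
have piL : linear pi.
  by move=> c x y; rewrite /pi raddfD /= fgliftZ.
pose pi' : {linear {freeg M / S} -> M} := HB.pack pi (GRing.isLinear.Build _ _ _ _ pi piL).
move=> Mp; have [y|h hP] := Mp _ _ pi' idfun; first by exists << y >>; rewrite /= /pi liftU scale1r.
move=> f fC f0; have [s|s|g [gC gf]] := @kex_freeg M i (fun s => h (f s)).
- by have := fC s; case: eqP => // _ ->; rewrite linear0.
- by rewrite kd_linear f0 linear0.
exists (fun s => pi' (g s)); split=> s; last by rewrite kd_linear gf hP.
by have := gC s; case: eqP => // _ ->; rewrite linear0.
Qed.

Lemma kex_proj_res (J : S -> Prop) (F : projective_resolution J) d :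
  (forall i, (d < i)%N -> forall x : pr_mod F i, x = 0) ->
  forall i, (d < i)%N -> kex (fun (c : nat) (p : S^o) => J p) i.
Proof.
move=> F0 [//|i] di.
apply: (kex_ext (P := imfam (pr_aug F) (@allfam _))).
  move=> c x; split=> [[y _ <-]|/(pr_image F)[y <-]]; last by exists y.
  by apply/(pr_image F); exists y.
have PF j : kfamily (@allfam (pr_mod F j)) by apply: allfamF.
have Pex j k : kex (@allfam (pr_mod F j)) k.+1.
  by apply: kex_projective; apply: pr_projective.
have a0 c x : allfam c x /\ pr_aug F x = 0 <-> imfam (pr_diff F 0) (@allfam _) c x.
  split=> [[_ /pr_exact0[y <-]]|[y _ <-]]; first by exists y.
  by split => //; apply/pr_exact0; exists y.
have d0 j c x : allfam c x /\ pr_diff F j x = 0 <-> imfam (pr_diff F j.+1) (@allfam _) c x.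
  split=> [[_ /pr_exactS[y <-]]|[y _ <-]]; first by exists y.
  by split => //; apply/pr_exactS; exists y.
apply/(kex_resolution PF Pex a0 d0).
(* Past the end of the resolution the image is zero, so [f] is zero. *)
move=> f fC _; exists (fun=> 0); split=> s.
  by case: eqP => // _; exists 0; rewrite // linear0.
rewrite [LHS]kdiff_eq0 //; have := fC s; case: eqP => [_ [y _ <-]|//].
by rewrite (F0 _ di y) linear0.
Qed.

End Projective.

(** * Betti numbers as Koszul homology *)

Section RowMaps.
Variables (K : fieldType) (n : nat).
Notation S := {mpoly K[n]}.

Definition row_map r r' (A : 'M[S]_(r, r')) : {linear 'rV[S]_r -> 'rV[S]_r'} := mulmxr A.

Definition row_form r (A : 'cV[S]_r) (v : 'rV[S]_r) : S^o := (v *m A) 0 0.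

Lemma row_form_linear r (A : 'cV[S]_r) : linear (row_form A).
Proof. by move=> c x y; rewrite /row_form mulmxDl -scalemxAl !mxE. Qed.

HB.instance Definition _ r (A : 'cV[S]_r) :=
  GRing.isLinear.Build S 'rV[S]_r S^o *:%R (row_form A) (row_form_linear A).

Lemma mulmx_row_form r (A : 'cV[S]_r) v : (v *m A = 0) <-> row_form A v = 0.
Proof.
split=> [h|h]; first by rewrite /row_form h mxE.
by apply/rowP => j; rewrite (ord1 j) [RHS]mxE.
Qed.

Lemma imfam_row_form (J : S -> Prop) (B : pred 'X_{1..n}) T r (d : 'I_r -> nat) (A : 'cV[S]_r) :
  (forall p, J p <-> {in msupp p, forall m, B m}) ->
  (forall p, J p <-> exists v : 'rV_r, (v *m A) 0 0 = p) ->
  homog_mx d (fun=> 0%N) A ->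
  forall c p, imfam (row_form A) (hfam (pred1 T) d) c p <-> mfam B (pred1 T) c p.
Proof.
move=> JB JA hA c p; split=> [[v hv <-]|hp].
  have /JB h : J (row_form A v) by apply/JA; exists v.
  move=> m ms; rewrite h //.
  have h' := hfam_mul hA hv; have := h' 0 m ms.
  by rewrite /= addn0.
have /JA[v vp] : J p by apply/JB => m /hp /andP[].
exists (hproj (pred1 T) d c v); first exact: hfam_hproj.
rewrite /= /row_form -(hproj_mul _ _ _ hA) mxE vp mproj_id // => m /hp /andP[_].
by rewrite /= addn0.
Qed.

End RowMaps.

Section TorKoszul.
Variables (K : fieldType) (n : nat) (J : {mpoly K[n]} -> Prop) (B : pred 'X_{1..n}).
Hypothesis JB : forall p, J p <-> {in msupp p, forall m, B m}.
Variables (F : graded_free_resolution J) (T : nat).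
Notation S := {mpoly K[n]}.
Notation deg i := (@gf_deg K n J F i).
Notation fam i := (hfam (pred1 T) (@gf_deg K n J F i)).

Lemma aug_homog : homog_mx (deg 0) (fun=> 0%N) (gf_aug F).
Proof.
move=> k l m; rewrite (ord1 l) addn0.
by have /dhomogP h := gf_aug_homog (g := F) k; move/h.
Qed.

Lemma diff_homog i : homog_mx (deg i.+1) (deg i) (gf_diff F i).
Proof. exact: gf_diff_homog. Qed.

Lemma fam_aug0 c v : fam 0 c v /\ row_form (gf_aug F) v = 0 <->
  imfam (row_map (gf_diff F 0)) (fam 1) c v.
Proof.
rewrite -mulmx_row_form; split=> [[hv /gf_exact0[w wv]]|[w hw <-]].
  exists (hproj (pred1 T) (deg 1) c w); first exact: hfam_hproj.
  by rewrite /= -(hproj_mul _ _ _ (@diff_homog 0)) wv hproj_id.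
split; first exact: hfam_mul (@diff_homog 0) hw.
by apply/gf_exact0; exists w.
Qed.

Lemma fam_diff0 i c v : fam i.+1 c v /\ row_map (gf_diff F i) v = 0 <->
  imfam (row_map (gf_diff F i.+1)) (fam i.+2) c v.
Proof.
split=> [[hv /gf_exactS[w wv]]|[w hw <-]].
  exists (hproj (pred1 T) (deg i.+2) c w); first exact: hfam_hproj.
  by rewrite /= -(hproj_mul _ _ _ (@diff_homog i.+1)) wv hproj_id.
split; first exact: hfam_mul (@diff_homog i.+1) hw.
by apply/gf_exactS; exists w.
Qed.

Lemma imfam_aug c p : imfam (row_form (gf_aug F)) (fam 0) c p <-> mfam B (pred1 T) c p.
Proof. exact: imfam_row_form JB (gf_image F) aug_homog c p. Qed.

Notation const v := (map_mx (fun p : S => p@_0%MM) v).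

Definition supp_deg r (d : 'I_r -> nat) (u : 'rV[K]_r) := forall k, u 0 k != 0 -> d k = T.

Lemma const_supp r (d : 'I_r -> nat) v : hfam (pred1 T) d 0 v -> supp_deg d (const v).
Proof.
move=> hv k; rewrite mxE -mcoeff_msupp => /hv /=.
by rewrite mdeg0 !add0n => /eqP.
Qed.

Lemma hfam_const r (d : 'I_r -> nat) (u : 'rV[K]_r) : supp_deg d u ->
  hfam (pred1 T) d 0 (map_mx (@mpolyC n K) u).
Proof.
move=> hu k m; rewrite mxE msuppC; case: eqVneq => // /hu hk.
by rewrite inE => /eqP->; rewrite /= mdeg0 !add0n hk.
Qed.

Lemma const_mpolyC r (u : 'rV[K]_r) : const (map_mx (@mpolyC n K) u) = u.
Proof. by apply/rowP => k; rewrite !mxE mcoeffC eqxx mulr1. Qed.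

Lemma const_mul r r' (v : 'rV[S]_r) (A : 'M_(r, r')) :
  const (v *m A) = const v *m map_mx (fun p : S => p@_0%MM) A.
Proof. exact: map_mxM. Qed.

Definition ker_im i (cyc : 'rV[K]_(gf_rank F i) -> Prop) :=
  forall u, supp_deg (deg i) u -> cyc u ->
  exists2 w, supp_deg (deg i.+1) w & w *m tor_diff F i = u.

(** As the kernel of [rho] is the image of the differential, [v] is a boundary modulo the maximal
    ideal exactly when [rho v] lies in the maximal ideal times the image of [rho]. For [rho] one
    takes the augmentation or the preceding differential. *)
Lemma ker_imP i (N : lmodType S) (rho : {linear 'rV[S]_(gf_rank F i) -> N})
    (cyc : 'rV[K]_(gf_rank F i) -> Prop) :
  (forall c v, fam i c v /\ rho v = 0 <-> imfam (row_map (gf_diff F i)) (fam i.+1) c v) ->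
  ker_im cyc <-> forall v, fam i 0 v -> cyc (const v) -> kin (imfam rho (fam i)) (rho v).
Proof.
move=> rho0; have famF : @kfamily K n _ (fam i) by apply: hfamF.
split=> h.
  move=> v hv cv; have [w hw wv] := h _ (const_supp hv) cv.
  set w' := map_mx (@mpolyC n K) w.
  have [hD rD] : fam i 0 (w' *m gf_diff F i) /\ rho (w' *m gf_diff F i) = 0.
    by apply/rho0; exists w' => //; apply: hfam_const.
  have hvw : fam i 0 (v - w' *m gf_diff F i) by case: famF => _ + _; apply.
  have [|q [qP qE]] := hfam_const0 hvw.
    move=> k; have : const (w' *m gf_diff F i) = const v by rewrite const_mul const_mpolyC.
    move/(congr1 (fun u : 'rV_(gf_rank F i) => u 0 k)); rewrite [LHS]mxE [RHS]mxE => e.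
    have -> : (v - w' *m gf_diff F i) 0 k = v 0 k - (w' *m gf_diff F i) 0 k by rewrite !mxE.
    by rewrite mcoeffB e subrr.
  exists (fun l => rho (q l)); split=> [l|]; first by exists (q l).
  have -> : rho v = rho (v - w' *m gf_diff F i) by rewrite linearB rD subr0.
  by rewrite qE linear_sum; apply: eq_bigr => l _; rewrite linearZ.
move=> u su cu; set v := map_mx (@mpolyC n K) u.
have hv : fam i 0 v by apply: hfam_const.
have [|p [pP pE]] := h v hv; first by rewrite const_mpolyC.
have /choice_fun[q qP] : forall l, exists x, fam i 1 x /\ rho x = p l.
  by move=> l; case: (pP l) => x; exists x.
have sq : fam i 0 (\sum_l 'X_l *: q l).
  by apply: kfamily_sum => // l _; case: famF => _ _; apply; case: (qP l).
have [w hw wv] : imfam (row_map (gf_diff F i)) (fam i.+1) 0 (v - \sum_l 'X_l *: q l).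
  apply/rho0; split; first by case: famF => _ + _; apply.
  rewrite linearB pE linear_sum; apply/eqP; rewrite subr_eq0; apply/eqP.
  by apply: eq_bigr => l _; rewrite linearZ /=; case: (qP l) => _ ->.
exists (const w); first exact: const_supp hw.
rewrite -[LHS]const_mul -[_ *m _]/(row_map (gf_diff F i) w) wv.
apply/rowP => k; rewrite [LHS]mxE.
have -> : (v - \sum_l 'X_l *: q l) 0 k = v 0 k - (\sum_l 'X_l *: q l) 0 k by rewrite !mxE.
rewrite mcoeffB /v [X in X@_0%MM - _]mxE mcoeffC eqxx mulr1 -[RHS]subr0; congr (_ - _).
apply: (@kin_const0 _ _ (pred1 T) _ (deg i)); exists q; split => // l.
by case: (qP l).
Qed.

Lemma tor_partP i (u : 'rV[K]_(gf_rank F i)) :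
  (u <= tor_part F i T)%MS <-> supp_deg (deg i) u.
Proof.
split=> [/submxP[x ->] k|hu].
  by rewrite mul_mx_diag !mxE; case: (eqVneq (deg i k) T) => // _; rewrite mulr0 eqxx.
apply/submxP; exists u; apply/rowP => k; rewrite mul_mx_diag !mxE.
by have [->|/hu->] := eqVneq (u 0 k) 0; rewrite ?mul0r // eqxx mulr1.
Qed.

Lemma tor_boundaryP i (u : 'rV[K]_(gf_rank F i)) :
  (u <= tor_part F i.+1 T *m tor_diff F i)%MS <->
  exists2 w, supp_deg (deg i.+1) w & w *m tor_diff F i = u.
Proof.
split=> [/submxP[x ->]|[w /tor_partP/submxP[x ->] <-]].
  by exists (x *m tor_part F i.+1 T); [apply/tor_partP/submxMl | rewrite mulmxA].
by rewrite -mulmxA submxMl.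
Qed.

Lemma tor_dim_eq0 i :
  tor_dim F i T = 0%N <-> ker_im (fun u => (u <= tor_cycles F i)%MS).
Proof.
(* The subtraction of ranks truncates; this inclusion is what turns the value 0 into equality of
   cycles and boundaries. *)
have sub : (tor_part F i.+1 T *m tor_diff F i <= tor_part F i T :&: tor_cycles F i)%MS.
  apply/rV_subP => _ /tor_boundaryP[w hw <-].
  set w' := map_mx (@mpolyC n K) w.
  have wE : w *m tor_diff F i = const (w' *m gf_diff F i).
    by rewrite const_mul const_mpolyC.
  rewrite sub_capmx; apply/andP; split.
    by apply/tor_partP; rewrite wE; apply/const_supp/(hfam_mul (@diff_homog i))/hfam_const.
  case: i w hw w' wE => [|i] w hw w' wE; first exact: submx1.
  apply/sub_kermxP; rewrite wE -const_mul.
  have -> : w' *m gf_diff F i.+1 *m gf_diff F i = 0 by apply/gf_exactS; exists w'.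
  by apply/rowP => k; rewrite !mxE mcoeff0.
have [_ eq_rank] := mxrank_leqif_sup sub.
transitivity (tor_part F i T :&: tor_cycles F i <= tor_part F i.+1 T *m tor_diff F i)%MS.
  rewrite -eq_rank; split=> [/eqP|/eqP e]; last by rewrite /tor_dim e subnn.
  by rewrite /tor_dim subn_eq0 eqn_leq (mxrankS sub).
split=> [/rV_subP h u hu cu|h].
  by apply/tor_boundaryP/h; rewrite sub_capmx cu andbT; apply/tor_partP.
apply/rV_subP => u; rewrite sub_capmx => /andP[/tor_partP hu cu].
by apply/tor_boundaryP/h.
Qed.

(** In positive degree, dimension shifting asks whether image elements without constant coefficients
    lie in the maximal ideal times the image. A row has such an image exactly when its constant part
    is a cycle. *)
Lemma tor_dim_kex i : tor_dim F i T = 0%N <-> kex (mfam B (pred1 T) : nat -> S^o -> Prop) i.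
Proof.
have famF j : @kfamily K n _ (fam j) by apply: hfamF.
have augF := imfamF (row_form (gf_aug F)) (famF 0%N).
transitivity (kex (imfam (row_form (gf_aug F)) (fam 0)) i); last first.
  by split; apply: kex_ext => c p; [|symmetry]; apply: imfam_aug.
rewrite tor_dim_eq0; case: i => [|i].
  rewrite (ker_imP _ fam_aug0) (kex0P augF); split=> [h y [v hv <-]|h v hv _].
    by apply: h => //; apply: submx1.
  by apply: h; exists v.
have Pex j k : @kex K n _ (fam j) k.+1 by apply: kex_rows.
rewrite (kex_resolution famF Pex fam_aug0 fam_diff0) (ker_imP _ (@fam_diff0 i)).
rewrite (kinj0P (famF i) (imfamF _ (famF i.+1))); split=> [h x [v hv <-] xP|h v hv cv].
  apply: h => //; apply/sub_kermxP; rewrite -const_mul; apply/rowP => k.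
  by rewrite mxE [RHS]mxE (kin_const0 xP).
apply: h; first by exists v.
apply: hfam_const0; first exact: hfam_mul (@diff_homog i) hv.
move=> k; have /sub_kermxP := cv; rewrite -const_mul => /(congr1 (fun u : 'rV_(gf_rank F i) => u 0 k)).
by rewrite [LHS]mxE [RHS]mxE.
Qed.

End TorKoszul.

(** The criterion is the same for all resolutions, hence holds for the one behind the choice in
    [betti]; [F] witnesses that there is one. *)
Lemma betti_kex (K : fieldType) (n : nat) (J : {mpoly K[n]} -> Prop) (B : pred 'X_{1..n})
    (F : graded_free_resolution J) i T :
  (forall p, J p <-> {in msupp p, forall m, B m}) ->
  betti J i T = 0%N <-> kex (mfam B (pred1 T) : nat -> {mpoly K[n]}^o -> Prop) i.
Proof.
move=> JB; rewrite /betti.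
have := @epsilon_spec nat (inhabits 0%N) (fun b => exists F : graded_free_resolution J, tor_dim F i T = b).
case=> [|F' <-]; first by exists (tor_dim F i T), F.
exact: tor_dim_kex.
Qed.

(** * Minimal graded free resolutions *)

Lemma ex_least (P : nat -> Prop) : (exists m, P m) ->
  exists m, P m /\ forall j, P j -> (m <= j)%N.
Proof.
move=> [m Pm]; apply: NNPP => h.
suff nP j : ~ P j by apply: nP Pm.
elim/ltn_ind: j => j IH Pj; apply: h; exists j; split => // i Pi.
by rewrite leqNgt; apply/negP => /IH.
Qed.

(** Greedy extension: while some [phi a] is missing, the dimension of the span grows, and that of
    [V] bounds it. *)
Lemma fin_span (K : fieldType) (V : vectType K) (A : eqType) (P : A -> Prop) (phi : A -> V) :
  exists s : seq A, (forall a, a \in s -> P a) /\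
    forall a, P a -> phi a \in <<[seq phi x | x <- s]>>%VS.
Proof.
suff H m : exists s : seq A, (forall a, a \in s -> P a) /\
    ((forall a, P a -> phi a \in <<[seq phi x | x <- s]>>%VS) \/
     (m <= \dim <<[seq phi x | x <- s]>>)%N).
  have [s [sP [h|h]]] := H (\dim {:V}).+1; first by exists s.
  by move: h; rewrite ltnNge dimvS // subvf.
elim: m => [|m [s [sP [h|h]]]]; first by exists [::]; split; [|right].
  by exists s; split => //; left.
case: (classic (forall a, P a -> phi a \in <<[seq phi x | x <- s]>>%VS)) => [c|c].
  by exists s; split => //; left.
have [a [Pa na]] : exists a, P a /\ phi a \notin <<[seq phi x | x <- s]>>%VS.
  apply: NNPP => h'; apply: c => a Pa; apply: NNPP => /negP na; apply: h'.
  by exists a.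
exists (a :: s); split; first by move=> b; rewrite inE => /predU1P[->|/sP].
right; apply: leq_ltn_trans h _ => /=.
have sub : (<<[seq phi x | x <- s]>> <= <<phi a :: [seq phi x | x <- s]>>)%VS.
  by rewrite span_cons addvSr.
rewrite ltn_neqAle dimvS // andbT (dimv_leqif_sup sub).2.
apply: contra na => /subvP; apply.
by apply: memv_span; rewrite inE eqxx.
Qed.

Section Generators.
Variables (K : fieldType) (n r : nat) (deg : 'I_r -> nat).
Notation S := {mpoly K[n]}.
Notation fam T := (hfam (pred1 T) deg).
Variable Z : 'rV[S]_r -> Prop.
Hypotheses (Z0 : Z 0) (ZB : forall x y, Z x -> Z y -> Z (x - y)).
Hypotheses (ZS : forall (a : S) x, Z x -> Z (a *: x)).
Hypothesis Zh : forall (T : nat) v, Z v -> Z (hproj (pred1 T) deg 0 v).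

Definition hsub (T : nat) c v := Z v /\ fam T c v.

Lemma hsubF T : @kfamily K n _ (hsub T).
Proof.
have [F0 FB FX] : @kfamily K n _ (fam T) by apply: hfamF.
split=> [c|c x y [Zx Fx] [Zy Fy]|c l x [Zx Fx]]; first by split.
  by split; [apply: ZB | apply: FB].
by split; [apply: ZS | apply: FX].
Qed.

Lemma hsub_const T (a : K) v : hsub T 0 v -> hsub T 0 (a%:MP *: v).
Proof.
move=> [Zv Fv]; split; first exact: ZS.
by move=> k m; rewrite mxE mul_mpolyC => /msuppZ_le /Fv.
Qed.

Implicit Types v : 'rV[S]_r.

Lemma gens_degree T : exists r' (A : 'M[S]_(r', r)), (forall i, hsub T 0 (row i A)) /\
  forall v, hsub T 0 v -> exists w, w *m A = v.
Proof.
(* Basis elements have nonnegative degree, so an element of degree [T] is determined by its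
   coefficients at monomials of degree at most [T]. *)
pose phi (v : 'rV[S]_r) : 'M[K]_(r, #|{: 'X_{1..n < T.+1}}|) :=
  \matrix_(k, j) (v 0 k)@_(val (enum_val j : 'X_{1..n < T.+1})).
have [s [sP sE]] := fin_span (hsub T 0) phi.
pose X := in_tuple [seq phi x | x <- s].
have sN (i : 'I_(size [seq phi x | x <- s])) : (i < size s)%N.
  by rewrite -[X in (_ < X)%N](size_map phi).
pose A : 'M[S]_(size [seq phi x | x <- s], r) := \matrix_(i < _) s`_i.
have rA i : row i A = s`_i by rewrite rowK.
have hA i : hsub T 0 (row i A) by rewrite rA; apply: sP; apply: mem_nth.
exists _, A; split => // v hv.
pose w : 'rV[S]_(size [seq phi x | x <- s]) := \row_i (coord X i (phi v))%:MP.
exists w; apply/eqP; rewrite -subr_eq0; apply/eqP.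
have wA : w *m A = \sum_i (coord X i (phi v))%:MP *: row i A.
  by rewrite mulmx_sum_row; apply: eq_bigr => i _; rewrite mxE.
have [_ hu] : hsub T 0 (w *m A - v).
  have [_ FB _] := hsubF T; apply: FB => //.
  by rewrite wA; apply: kfamily_sum => [|i _]; [apply: hsubF | apply: hsub_const].
apply/rowP => k; rewrite [RHS]mxE; apply/mpolyP => m; rewrite mcoeff0.
have [mu|/memN_msupp_eq0//] := boolP (m \in msupp ((w *m A - v) 0 k)).
have mT : (mdeg m < T.+1)%N.
  by have := hu k m mu; rewrite /= addn0 ltnS => /eqP<-; apply: leq_addr.
have -> : (w *m A - v) 0 k = (w *m A) 0 k - v 0 k by rewrite !mxE.
rewrite mcoeffB wA summxE raddf_sum /=.
have := coord_span (X := X) (sE v hv).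
move/(congr1 (fun M : 'M_(_, _) => M k (enum_rank (BMultinom mT)))).
have phiE u : phi u k (enum_rank (BMultinom mT)) = (u 0 k)@_m by rewrite mxE enum_rankK.
rewrite phiE => ->; rewrite summxE.
apply/eqP; rewrite subr_eq0; apply/eqP/eq_bigr => i _.
rewrite mxE mcoeffCM [RHS]mxE; congr (_ * _).
by rewrite (nth_map 0) // phiE rA.
Qed.

Definition hgens r' (deg' : 'I_r' -> nat) (A : 'M[S]_(r', r)) :=
  (forall i, hsub (deg' i) 0 (row i A)) /\ forall v, Z v -> exists w, w *m A = v.

Lemma gens_below m : exists r' (deg' : 'I_r' -> nat) (A : 'M[S]_(r', r)),
  (forall i, hsub (deg' i) 0 (row i A)) /\
  forall T v, (T < m)%N -> hsub T 0 v -> exists w, w *m A = v.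
Proof.
elim: m => [|m [r1 [d1 [A1 [h1 g1]]]]].
  by exists 0%N, (fun=> 0%N), 0; split => [[]|].
have [r2 [A2 [h2 g2]]] := gens_degree m.
exists (r1 + r2)%N, (fun i => if split i is inl j then d1 j else m), (col_mx A1 A2).
split=> [i|T v].
  case: (split_ordP i) => j ->; first by rewrite rowKu.
  by rewrite rowKd.
rewrite ltnS leq_eqVlt => /predU1P[->|Tm] hv.
  have [w <-] := g2 v hv; exists (row_mx 0 w).
  by rewrite mul_row_col mul0mx add0r.
have [w <-] := g1 T v Tm hv; exists (row_mx w 0).
by rewrite mul_row_col mul0mx addr0.
Qed.

Lemma hsub_low T l (p : 'I_n -> 'rV[S]_r) : hsub T.+1 1 (p l) -> hsub T 0 (p l).
Proof.
move=> [Zp Fp]; split => // k m /Fp /=.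
by rewrite addn1 addSn eqSS addn0.
Qed.

Lemma hsub_pred0 v : hsub 0 1 v -> v = 0.
Proof.
move=> [_ Fv]; apply/rowP => k; rewrite [RHS]mxE; apply/mpolyP => m; rewrite mcoeff0.
by apply: memN_msupp_eq0; apply/negP => /Fv /=; rewrite addn1 addSn.
Qed.

Lemma hproj_sum v : exists m, v = \sum_(T < m) hproj (pred1 (T : nat)) deg 0 v.
Proof.
exists (\max_(k < r) (msize (v 0%R k) + deg k))%N.
apply/rowP => k; rewrite summxE; apply/mpolyP => m; rewrite raddf_sum /=.
under eq_bigr => T _ do rewrite mxE mcoeff_mproj /= addn0.
have [mv|/memN_msupp_eq0->] := boolP (m \in msupp (v 0 k)); last first.
  by rewrite big1 // => T _; rewrite if_same.
have lt : (mdeg m + deg k < \max_(k < r) (msize (v 0%R k) + deg k))%N.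
  by apply: leq_trans (leq_bigmax k); rewrite ltn_add2r msize_mdeg_lt.
rewrite (bigD1 (Ordinal lt)) //= eqxx big1 ?addr0 // => T.
by rewrite eq_sym -(inj_eq val_inj) /= => /negbTE->.
Qed.

Lemma hsub_hproj (T : nat) v : Z v -> hsub T 0 (hproj (pred1 T) deg 0 v).
Proof. by move=> Zv; split; [apply: Zh | apply: hfam_hproj]. Qed.

(** Graded Nakayama takes the place of the Hilbert basis theorem: above degree [N] everything is a
    combination of elements one degree lower, so generators up to [N] suffice. *)
Lemma exists_hgens N : (forall (T : nat) v, (N < T)%N -> hsub T 0 v -> kin (hsub T) v) ->
  exists r' (deg' : 'I_r' -> nat) A, hgens deg' A.
Proof.
move=> hN; have [r' [d [A [hA gA]]]] := gens_below N.+1.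
exists r', d, A; split => // v Zv.
have gT : forall (T : nat) v, hsub T 0 v -> exists w, w *m A = v.
  elim=> [|T IH] u hu; first exact: gA hu.
  have [TN|NT] := leqP T.+1 N; first by apply: gA hu.
  have [p [pP ->]] := hN _ _ NT hu.
  have /choice_fun[q qP] : forall l, exists w, w *m A = p l.
    by move=> l; apply: IH; apply: hsub_low.
  exists (\sum_l 'X_l *: q l); rewrite mulmx_suml; apply: eq_bigr => l _.
  by rewrite -scalemxAl qP.
have [m ->] := hproj_sum v.
have /choice_fun[q qP] : forall T : 'I_m, exists w, w *m A = hproj (pred1 (T : nat)) deg 0 v.
  by move=> T; apply: gT (hsub_hproj T Zv).
by exists (\sum_T q T); rewrite mulmx_suml; apply: eq_bigr.
Qed.

Lemma hgens_homog r' (deg' : 'I_r' -> nat) A : hgens deg' A -> homog_mx deg' deg A.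
Proof.
move=> [hA _] k l m mA; have [_ /(_ l m)] := hA k.
by rewrite mxE => /(_ mA) /=; rewrite addn0 => /eqP.
Qed.

Notation const v := (map_mx (fun p : S => p@_0%MM) v).

(* If some relation among the generators had an invertible coefficient, the
   corresponding generator could be dropped. *)
Lemma hgens_least r' (deg' : 'I_r' -> nat) A : hgens deg' A ->
  (forall r2 (d2 : 'I_r2 -> nat) A2, hgens d2 A2 -> (r' <= r2)%N) ->
  forall w : 'rV_r', w *m A = 0 -> const w = 0.
Proof.
move=> hA least w wA; have [hA1 hA2] := hA.
case: r' deg' A hA least w wA hA1 hA2 => [|r'] deg' A hA least w wA hA1 hA2.
  by apply/rowP => -[].
apply/rowP => k; rewrite [RHS]mxE [LHS]mxE; apply/eqP/negPn/negP => c0.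
set c := (w 0 k)@_0%MM in c0.
(* In the part of degree [deg' k] of the relation, the coefficient at [k] is the constant [c]
   itself, hence invertible. *)
pose w1 := hproj (pred1 (deg' k)) deg' 0 w.
have w1A : w1 *m A = 0.
  rewrite -(hproj_mul _ _ _ (hgens_homog hA)) wA.
  by apply/rowP => l; rewrite !mxE mproj0.
have w1k : w1 0 k = c%:MP.
  apply/mpolyP => m; rewrite mxE mcoeff_mproj /= addn0 mcoeffC -[X in _ == X]add0n eqn_add2r.
  by rewrite mdeg_eq0; case: eqP => [->|_]; rewrite ?mulr1 ?mulr0.
suff h : hgens (fun i => deg' (fintype.lift k i)) (row' k A) by have := least _ _ _ h; rewrite ltnn.
split=> [i|v Zv].
  have -> : row i (row' k A) = row (fintype.lift k i) A by apply/rowP => l; rewrite !mxE.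
  exact: hA1.
have [u <-] := hA2 v Zv.
pose u' := u - (u 0 k * (c^-1)%:MP) *: w1.
have u'k : u' 0 k = 0.
  have -> : u' 0 k = u 0 k - u 0 k * (c^-1)%:MP * w1 0 k by rewrite !mxE.
  by rewrite w1k -mulrA -mpolyCM mulVf // mpolyC1 mulr1 subrr.
have -> : u *m A = u' *m A by rewrite mulmxBl -scalemxAl w1A scaler0 subr0.
exists (col' k u'); apply/rowP => l; rewrite !mxE (bigD1_ord k) //= u'k mul0r add0r.
by apply: eq_bigr => i _; rewrite !mxE.
Qed.

Lemma minimal_cover N : (forall (T : nat) v, (N < T)%N -> hsub T 0 v -> kin (hsub T) v) ->
  exists r' (deg' : 'I_r' -> nat) (A : 'M[S]_(r', r)),
  [/\ homog_mx deg' deg A, forall v, Z v <-> exists w, w *m A = v,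
      forall w : 'rV_r', w *m A = 0 -> const w = 0 &
      (forall (T : nat) v, hsub T 0 v -> kin (hsub T) v) -> r' = 0%N].
Proof.
move=> /exists_hgens/ex_least[r' [[d [A hA]] least]].
exists r', d, A; split.
- exact: hgens_homog hA.
- have [hA1 hA2] := hA; move=> v; split=> [/hA2//|[w <-]].
  rewrite mulmx_sum_row; apply: big_ind => //.
    move=> x y Zx Zy; rewrite -[y]opprK; apply: (ZB Zx); rewrite -sub0r; exact: ZB.
  by move=> i _; apply: ZS; have [] := hA1 i.
- by apply: (hgens_least hA) => r2 d2 A2 h2; apply: least; exists d2, A2.
move=> hk; have hz : forall (T : nat) v, hsub T 0 v -> v = 0.
  elim=> [|T IH] v hv; have [p [pP ->]] := hk _ _ hv; apply: big1 => l _.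
    by rewrite (hsub_pred0 (pP l)) scaler0.
  by rewrite (IH (p l)) ?scaler0 //; apply: hsub_low.
apply/eqP; rewrite -leqn0; apply: least; exists (fun=> 0%N), 0; split=> [[]//|v Zv].
exists 0; rewrite mul0mx; have [m ->] := hproj_sum v.
by rewrite big1 // => T _; apply: (hz T); apply: hsub_hproj.
Qed.

End Generators.

Section MinimalResolution.
Variables (K : fieldType) (n : nat) (J : {mpoly K[n]} -> Prop) (B : pred 'X_{1..n}).
Hypothesis JB : forall p, J p <-> {in msupp p, forall m, B m}.
Hypothesis BD : forall m m', B m -> B (m + m')%MM.
Notation S := {mpoly K[n]}.
Notation kexJ T i := (kex (mfam B (pred1 T) : nat -> S^o -> Prop) i).
Variable N : nat.
Hypothesis hN : forall T i, (N < T)%N -> kexJ T i.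
Notation const v := (map_mx (fun p : S => p@_0%MM) v).

(* A differential [F_{k+1} -> F_k] of the resolution under construction. *)
Record stage := Stage {
  st_rank : nat; st_deg : 'I_st_rank -> nat;
  st_rank' : nat; st_deg' : 'I_st_rank' -> nat;
  st_mx : 'M[S]_(st_rank', st_rank)
}.
Arguments st_deg : clear implicits.
Arguments st_deg' : clear implicits.

Notation fam T s := (hfam (pred1 T) (st_deg' s)).

Definition st_ker s (T : nat) := kerfam (row_map (st_mx s)) (fam T s).
Arguments st_ker : clear implicits.

(** The second clause is minimality. The third carries dimension shifting along: vanishing for [J]
    in position [i + k.+1] makes the homology of the kernel at stage [k] inject in position [i]. *)
Definition good k s := [/\ homog_mx (st_deg' s) (st_deg s) (st_mx s),
  forall w : 'rV_(st_rank' s), w *m st_mx s = 0 -> const w = 0 &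
  forall i (T : nat), kexJ T (i + k.+1) -> kinj (fam T s) (st_ker s T) i].

Definition next_of s (x : {r2 : nat & (('I_r2 -> nat) * 'M[S]_(r2, st_rank' s))%type}) : stage :=
  Stage (st_deg' s) (projT2 x).1 (projT2 x).2.

(** Being vacuous for stages that are not good, it can be met at every stage, which makes [next]
    total. A stage does not record its index, hence the quantifier over [k]. *)
Definition covers s (x : {r2 : nat & (('I_r2 -> nat) * 'M[S]_(r2, st_rank' s))%type}) :=
  forall k, good k s -> [/\ good k.+1 (next_of x),
    forall v : 'rV_(st_rank' s), v *m st_mx s = 0 <-> exists w, w *m (projT2 x).2 = v &
    (forall T, kexJ T k.+1) -> projT1 x = 0%N].

Lemma famF T s : @kfamily K n _ (fam T s).
Proof. exact: hfamF. Qed.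

(** By minimality a kernel element lies in the maximal ideal times the free module; injectivity in
    position 0 puts it in the maximal ideal times the kernel. *)
Lemma good_kin k s T v : good k s -> kexJ T k.+1 -> st_ker s T 0 v -> kin (st_ker s T) v.
Proof.
move=> [_ hmin hkin] hT [Fv vK]; have := hkin 0%N T hT.
rewrite (kinj0P (famF T s) (kerfamF _ (famF T s))); apply; first by split.
apply: hfam_const0 => // l.
by have := congr1 (fun u : 'rV_(st_rank' s) => u 0 l) (hmin v vK); rewrite [LHS]mxE [RHS]mxE.
Qed.

Lemma covers_exists s : exists x, @covers s x.
Proof.
case: (classic (exists k, good k s)) => [[k gk]|ng]; last first.
  exists (existT _ 0%N (fun=> 0%N, 0)) => k gk; case: ng.
  by exists k.
have [hh _ _] := gk.
pose Z (v : 'rV[S]_(st_rank' s)) := v *m st_mx s = 0.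
have Z0 : Z 0 by rewrite /Z mul0mx.
have ZB x y : Z x -> Z y -> Z (x - y) by rewrite /Z mulmxBl => -> ->; rewrite subrr.
have ZS (a : S) x : Z x -> Z (a *: x) by rewrite /Z -scalemxAl => ->; rewrite scaler0.
have Zh (T : nat) v : Z v -> Z (hproj (pred1 T) (st_deg' s) 0 v).
  rewrite /Z -(hproj_mul _ _ _ hh) => ->.
  by apply/rowP => l; rewrite !mxE mproj0.
have kinE T v : kin (hsub (st_deg' s) Z T) v <-> kin (st_ker s T) v.
  by split=> -[p [pP pE]]; exists p; split => // l; have [] := pP l.
have hsubE T c v : hsub (st_deg' s) Z T c v <-> st_ker s T c v.
  by split=> -[].
have [|r2 [d2 [A [hA ZA Amin A0]]]] := minimal_cover Z0 ZB ZS Zh (N := N).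
  move=> T v NT /hsubE hv; apply/kinE; apply: (good_kin gk) => //.
  exact: hN.
exists (existT _ r2 (d2, A)) => j gj; split => //=; last first.
  move=> hT; apply: A0 => T v /hsubE hv; apply/kinE.
  exact: good_kin gj _ hv.
split => // i T hT; have [_ _ hj] := gj.
have ker_im c v : st_ker s T c v <-> imfam (row_map A) (hfam (pred1 T) d2) c v.
  split=> [[Fv /ZA[w wv]]|[w hw <-]].
    exists (hproj (pred1 T) d2 c w); first exact: hfam_hproj.
    by rewrite /= -(hproj_mul _ _ _ hA) wv hproj_id.
  split; first exact: hfam_mul hA hw.
  by apply/ZA; exists w.
have fF : @kfamily K n _ (hfam (pred1 T) d2) by apply: hfamF.
apply: (kex_im_kinj fF); apply: (kex_ext ker_im).
have sub c v : st_ker s T c v -> fam T s c v by case.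
have ex1 : @kex K n _ (fam T s) i.+1 by apply: kex_rows.
apply/(kinj_kex sub ex1); apply: hj.
by rewrite addSnnS.
Qed.

Definition next s := next_of (proj1_sig (constructive_indefinite_description _ (covers_exists s))).

Lemma good0_exists : exists r (d : 'I_r -> nat) (A : 'cV[S]_r),
  good 0 (@Stage 1 (fun=> 0%N) r d A) /\ forall p, J p <-> exists v : 'rV_r, (v *m A) 0 0 = p.
Proof.
pose Z (v : 'rV[S]_1) := J (v 0 0).
have Z0 : Z 0 by rewrite /Z mxE; apply/JB => m; rewrite msupp0.
have ZB x y : Z x -> Z y -> Z (x - y).
  rewrite /Z => /JB hx /JB hy; apply/JB; rewrite !mxE => m /msuppB_le.
  by rewrite mem_cat => /orP[/hx|/hy].
have ZS (a : S) x : Z x -> Z (a *: x).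
  rewrite /Z => /JB hx; apply/JB; rewrite !mxE => m /msuppM_le/allpairsP[[m1 m2] /= [h1 h2 ->]].
  by rewrite addmC; apply/BD/hx.
have Zh (T : nat) v : Z v -> Z (hproj (pred1 T) (fun=> 0%N) 0 v).
  rewrite /Z mxE => /JB hx; apply/JB => m; rewrite mcoeff_msupp mcoeff_mproj.
  by case: ifP; rewrite ?eqxx // -mcoeff_msupp => _ /hx.
have famE T c v : hsub (fun=> 0%N) Z T c v <-> mfam B (pred1 T) c (v 0 0).
  split=> [[/JB Zv Fv] m mv|h]; first by rewrite Zv //; have := Fv 0 m mv; rewrite /= addn0.
  split; first by apply/JB => m /h /andP[].
  by move=> k m; rewrite (ord1 k) => /h /andP[_]; rewrite /= addn0.
have mF T : @kfamily K n S^o (mfam B (pred1 T)).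
  split=> [c m|c x y hx hy m|c l x hx m]; first by rewrite msupp0.
    by move=> /msuppB_le; rewrite mem_cat => /orP[/hx|/hy].
  rewrite [_ *: _]mulrC (perm_mem (msuppMX _ _)) => /mapP[m' /hx h ->].
  by case/andP: h => hb hd; rewrite mdegD mdeg1 add1n addSnnS hd addmC BD.
have [|r [d [A [hA ZA Amin _]]]] := minimal_cover Z0 ZB ZS Zh (N := N).
  move=> T v NT /famE hv.
  have /(kex0P (mF T)) h := @hN T 0%N NT.
  have [p [pP pE]] := h _ hv.
  exists (fun l => const_mx (p l)); split=> [l|]; first by apply/famE; rewrite mxE; apply: pP.
  apply/rowP => k; rewrite (ord1 k) pE summxE; apply: eq_bigr => l _; by rewrite !mxE.
have JA p : J p <-> exists v : 'rV_r, (v *m A) 0 0 = p.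
  have := ZA (const_mx p); rewrite /Z mxE => ->; split=> -[w wp]; exists w.
    by rewrite wp mxE.
  by apply/rowP => k; rewrite (ord1 k) wp mxE.
exists r, d, A; split => //; split => // i T hT.
have fF : @kfamily K n _ (hfam (pred1 T) d) by apply: hfamF.
apply: (kinj_ext (Z := kerfam (row_form A) (hfam (pred1 T) d))).
  by move=> c v; rewrite /st_ker /kerfam /= (mulmx_row_form A v).
apply: (kex_im_kinj fF); rewrite addn1 in hT; apply: kex_ext hT => c p.
by symmetry; apply: imfam_row_form JB JA hA c p.
Qed.

Lemma minimal_resolution : exists F : graded_free_resolution J,
  forall d, (forall T i, (d < i)%N -> kexJ T i) -> forall i, (d < i)%N -> gf_rank F i = 0%N.
Proof.
have [r [d [A [g0 JA]]]] := good0_exists.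
(* Stage 0 is the augmentation, seen as a differential into the free module of rank one, so the
   differential [i] of the resolution is stage [i.+1]. *)
pose st := fix st k := if k is k'.+1 then next (st k') else @Stage 1 (fun=> 0%N) r d A.
have nextP k : good k (st k) -> _ := fun g =>
  proj2_sig (constructive_indefinite_description _ (covers_exists (st k))) k g.
have gst k : good k (st k) by elim: k => // k /nextP[].
have ex k (v : 'rV_(st_rank' (st k))) : v *m st_mx (st k) = 0 <-> exists w, w *m st_mx (st k.+1) = v.
  by have [_ h _] := nextP k (gst k); apply: h.
have hom k : homog_mx (st_deg' (st k)) (st_deg (st k)) (st_mx (st k)) by have [] := gst k.
have hom0 k : A k 0 \is (st_deg' (st 0%N) k).-homog.
  by apply/dhomogP => m /(hom 0%N k 0 m); rewrite /= addn0.
exists (@Build_graded_free_resolution K n J (fun i => st_rank' (st i)) (fun i => st_deg' (st i))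
  A (fun i => st_mx (st i.+1)) hom0 (fun i => hom i.+1) JA (ex 0%N) (fun i => ex i.+1)).
move=> b hb [//|i] bi /=.
have [_ _ h] := nextP i (gst i); apply: h => T; exact: hb.
Qed.

End MinimalResolution.

(** * Induced cycles in the complement *)

Section LowDegree.
Variables (K : fieldType) (n : nat) (e : rel 'I_n).
Hypotheses (e_sym : ssrbool.symmetric e) (e_irr : irreflexive e).
Implicit Types (s U W : {set 'I_n}) (f : {set 'I_n} -> K) (h : 'I_n -> K) (v x y : 'I_n).
Notation exC := (exC K e).

Lemma exC_no_face U k : (forall s, s \subset U -> stable e s -> #|s| <> k) -> exC U k.
Proof. by move=> hU f _; exists f => s sU /(hU s sU) h /h. Qed.

Lemma exC_0 U : U != set0 -> exC U 0.
Proof.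
case/set0Pn => u uU f fU; exists (fun=> 0) => s _ _ /cards0_eq ->.
rewrite cobd_eq0 //; apply/esym.
have := fU [set u]; rewrite sub1set uU cards1 => /(_ isT) h.
have : cobd f [set u] = 0.
  by apply: h => //; apply/stableP => i j; rewrite !inE => /eqP-> /eqP->; rewrite e_irr.
rewrite cobdE big_set1 setDv => /(congr1 (fun z => ksign K u (~: [set u]) * z)).
by rewrite mulrA ksign_sqr mul1r mulr0.
Qed.

(* With this sign, cocycles correspond to the functions that agree on any two
   vertices not joined by [e]. *)
Definition vtx f x : K := ksign K x (~: [set x]) * f [set x].

Lemma cobd_set1 f x : cobd f [set x] = ksign K x (~: [set x]) * f set0.
Proof. by rewrite cobdE big_set1 setDv. Qed.

Lemma vtx_cobd f x : vtx (cobd f) x = f set0.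
Proof. by rewrite /vtx cobd_set1 mulrA ksign_sqr mul1r. Qed.

Lemma vtx_eq f1 f2 x : vtx f1 x = vtx f2 x -> f1 [set x] = f2 [set x].
Proof.
move/(congr1 (fun z => ksign K x (~: [set x]) * z)).
by rewrite !mulrA ksign_sqr !mul1r.
Qed.

Lemma cobd_set2 f x y : x != y -> (cobd f [set x; y] == 0) = (vtx f x == vtx f y).
Proof.
move=> xy; set t := ~: [set x; y].
have xt : x \notin t by rewrite !inE eqxx.
have yt : y \notin t by rewrite !inE eqxx orbT.
have xtE : x |: t = ~: [set y].
  by apply/setP => j; rewrite !inE; case: (eqVneq j x) => [->|]; rewrite ?xy.
have ytE : y |: t = ~: [set x].
  by apply/setP => j; rewrite !inE; case: (eqVneq j y) => [->|]; rewrite ?orbF // eq_sym xy.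
have an := ksign_anti K xy xt yt; rewrite xtE ytE in an.
rewrite cobdE big_setU1 ?inE //= big_set1.
have -> : [set x; y] :\ x = [set y] by rewrite setU1K // inE.
have -> : [set x; y] :\ y = [set x] by rewrite setUC setU1K // inE eq_sym.
rewrite -/t.
have -> : f [set y] = ksign K y (~: [set y]) * vtx f y by rewrite mulrA ksign_sqr mul1r.
have -> : f [set x] = ksign K x (~: [set x]) * vtx f x by rewrite mulrA ksign_sqr mul1r.
move: (vtx f x) (vtx f y) => a b.
rewrite !mulrA an mulNr addrC -mulrBr mulf_eq0 subr_eq0.
have /negbTE-> // : ksign K y t * ksign K x (~: [set x]) != 0.
have nz l s : ksign K l s != 0.
  by apply/eqP => z; have := ksign_sqr K l s; rewrite z mul0r => /esym/eqP; rewrite oner_eq0.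
by rewrite mulf_neq0.
Qed.

Lemma stable2 x y : stable e [set x; y] = ~~ e x y.
Proof.
apply/stableP/idP => [|xy i j]; first by apply; rewrite !inE eqxx ?orbT.
by rewrite !inE => /orP[]/eqP-> /orP[]/eqP->; rewrite ?e_irr // e_sym.
Qed.

Definition locconst U h := {in U &, forall x y, ~~ e x y -> h x = h y}.

Lemma cocycle1P U f : cocycle e U 1 f <-> locconst U (vtx f).
Proof.
split=> [fU x y xU yU exy|fU s sU st /eqP/cards2P[x [y [xy es]]]].
  have [->//|xy] := eqVneq x y; apply/eqP; rewrite -cobd_set2 //; apply/eqP/fU.
  - by rewrite subUset !sub1set xU.
  - by rewrite stable2.
  - by rewrite cards2 xy.
move: sU st; rewrite es subUset !sub1set stable2 => /andP[xU yU] exy.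
by apply/eqP; rewrite cobd_set2 //; apply/eqP/fU.
Qed.

Lemma stable1 x : stable e [set x].
Proof. by apply/stableP => i j; rewrite !inE => /eqP-> /eqP->; rewrite e_irr. Qed.

Lemma coboundary1P U f : coboundary e U 1 f <-> exists c, {in U, forall x, vtx f x = c}.
Proof.
split=> [[g gf]|[c cU]].
  exists (g set0) => x xU; rewrite -(vtx_cobd g x) /vtx gf ?sub1set ?cards1 //.
  exact: stable1.
exists (fun=> c) => s sU _ /eqP/cards1P[x es]; move: sU; rewrite es sub1set => xU.
by apply: vtx_eq; rewrite vtx_cobd cU.
Qed.

Definition cochain1 h s : K := \sum_(x in s) ksign K x (~: [set x]) * h x.

Lemma vtx_cochain1 h x : vtx (cochain1 h) x = h x.
Proof. by rewrite /vtx /cochain1 big_set1 mulrA ksign_sqr mul1r. Qed.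

(** Reduced cohomology in dimension 0 measures connectedness of the complement graph on [U],
    expressed here without naming components. *)
Lemma exC_1P U : exC U 1 <-> forall h, locconst U h -> exists c, {in U, forall x, h x = c}.
Proof.
split=> [hU h hl|hU f /cocycle1P/hU[c cP]].
  have /hU/coboundary1P[c cP] : cocycle e U 1 (cochain1 h).
    by apply/cocycle1P => x y xU yU exy; rewrite !vtx_cochain1; apply: hl.
  by exists c => x xU; rewrite -vtx_cochain1 cP.
by apply/coboundary1P; exists c.
Qed.

Lemma exC_1_small U : {in U &, forall x y, x = y} -> exC U 1.
Proof.
move=> hU; apply/exC_1P => h _; have [->|[u uU]] := set_0Vmem U.
  by exists 0 => x; rewrite inE.
by exists (h u) => x xU; rewrite (hU x u).
Qed.

(** The link of [v] is two isolated points while [U] is connected, so [v] closes a path to a loop;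
    the link sequence detects it. *)
Lemma not_exC_suspension U v x y : v \notin U -> conbr e U v = [set x; y] ->
  x != y -> e x y -> exC U 1 -> ~ exC (v |: U) 2.
Proof.
move=> vU NE xy exy hU hW.
have := exC_link e_sym e_irr vU hU hW; rewrite NE => /exC_1P/(_ (fun z => (z == x)%:R)).
case=> [a b|c cP].
  rewrite !inE => /orP[]/eqP-> /orP[]/eqP->; rewrite ?exy ?(e_sym y) ?exy //.
have := cP x; have := cP y; rewrite !inE !eqxx orbT (eq_sym y) (negbTE xy) => <- // /(_ isT) /eqP.
by rewrite oner_eq0.
Qed.

Definition critical W := ~ exC W 2 /\ forall W' k, W' \proper W -> (1 < k)%N -> exC W' k.

Lemma exists_critical U k : (1 < k)%N -> ~ exC U k -> exists2 W : {set 'I_n}, W \subset U & critical W.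
Proof.
have [m] := ubnP #|U|; elim: m U k => // m IH U k Um k1 hU.
case: (classic (exists W' k', [/\ W' \proper U, (1 < k')%N & ~ exC W' k'])) => [|hno].
  move=> [W' [k' [WU k'1 hW']]].
  have [|W WW' cW] := IH W' k' _ k'1 hW'.
    by apply: leq_trans (proper_card WU) _.
  by exists W => //; apply: subset_trans WW' (proper_sub WU).
have min W' k' : W' \proper U -> (1 < k')%N -> exC W' k'.
  by move=> WU k'1; apply: NNPP => h; apply: hno; exists W', k'.
exists U => //; split => //.
have [U0|[v vU]] := set_0Vmem U.
  case: hU; apply: exC_no_face => s; rewrite U0 subset0 => /eqP->; rewrite cards0.
  by move=> _ k0; rewrite -k0 in k1.
have vn : v \notin U :\ v by rewrite !inE eqxx.
have UE : U = v |: (U :\ v) by rewrite setD1K.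
have pU : U :\ v \proper U by apply: properD1.
have pN : conbr e (U :\ v) v \proper U by apply: sub_proper_trans (conbrS _ _ _) pU.
(* From 3 on, minimality covers both the deletion and the link, and [exC_add] applies; at 2 the link
   would be needed in degree 1, where minimality says nothing. *)
case: k k1 hU => [|[|[|k]]] // _ hU; case: hU; rewrite UE.
by apply: (exC_add e_sym e_irr vn); apply: min.
Qed.

Section Critical.
Variable W : {set 'I_n}.
Hypothesis cW : critical W.

Lemma critical_link v : v \in W -> ~ exC (conbr e (W :\ v) v) 1.
Proof.
move=> vW hN; case: cW => [h min]; apply: h; rewrite -(setD1K vW).
apply: exC_add => //; first by rewrite !inE eqxx.
by apply: min => //; apply: properD1.
Qed.

Lemma critical_neq0 : exists v, v \in W.
Proof.
have [W0|[v vW]] := set_0Vmem W; last by exists v.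
case: cW => h _; case: h; apply: exC_no_face => s; rewrite W0 subset0 => /eqP->.
by rewrite cards0.
Qed.

Lemma critical_card : (2 < #|W|)%N.
Proof.
have [v vW] := critical_neq0; rewrite (cardsD1 v) vW ltnS.
apply: leq_trans (subset_leq_card (conbrS e (W :\ v) v)).
rewrite ltnNge; apply/negP => h; apply: (critical_link vW); apply: exC_1_small.
move=> x y xN yN; apply/eqP; apply: contraTT h => xy; rewrite -ltnNge.
have := @subset_leq_card _ [set x; y] (conbr e (W :\ v) v).
by rewrite cards2 xy subUset !sub1set xN yN; apply.
Qed.

End Critical.

End LowDegree.

(** * Cohomology when the complement is a cycle *)

Section Cycle.
Variables (K : fieldType) (n : nat) (e : rel 'I_n).
Hypotheses (e_sym : ssrbool.symmetric e) (e_irr : irreflexive e).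
Implicit Types (s U W : {set 'I_n}) (h : 'I_n -> K) (v x y : 'I_n).
Notation exC := (exC K e).
Notation critical := (critical K e).

Lemma ord_eqE (i j : 'I_n) : (i == j) = (i == j :> nat).
Proof. by []. Qed.

Lemma val_ordS (i : 'I_n) : ordS i = (if i.+1 == n then 0 else i.+1) :> nat.
Proof.
rewrite /=; case: eqP => [->|ne]; first by rewrite modnn.
by rewrite modn_small // ltn_neqAle ltn_ord andbT; apply/eqP.
Qed.

Lemma compl_graph_sym x y : compl_graph e x y = compl_graph e y x.
Proof. by rewrite /compl_graph eq_sym e_sym. Qed.

Lemma compl_locconst U h x y : locconst e U h -> x \in U -> y \in U ->
  compl_graph e x y -> h x = h y.
Proof. by move=> hU xU yU /andP[_]; apply: hU. Qed.

Section CycleGraph.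
Hypothesis n4 : (3 < n)%N.
Variable c : {perm 'I_n}.
Hypothesis cE : forall i j, compl_graph e (c i) (c j) = (j == ordS i) || (i == ordS j).

Let n0 : (0 < n)%N. Proof. by apply: leq_trans n4. Qed.
Let i0 := Ordinal n0.

Lemma cycle_const U h (a : nat) : locconst e U h ->
  (forall i : 'I_n, (a <= i)%N -> c i \in U) ->
  forall i j : 'I_n, val i = a -> (a <= j)%N -> h (c j) = h (c i).
Proof.
move=> hU aU i [j lj] /= ia aj.
elim: j lj aj => [|j IH] lj aj.
  by move: aj; rewrite leqn0 => /eqP a0; congr (h (c _)); apply: ord_inj; rewrite /= ia.
have [ja|ja] := ltnP j a.
  by congr (h (c _)); apply: ord_inj; rewrite /= ia; apply/eqP; rewrite eqn_leq ja aj.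
have lj' : (j < n)%N by apply: ltnW.
rewrite -(IH lj' ja); apply: (compl_locconst hU); try exact: aU.
rewrite cE; apply/orP; right; apply/eqP/ord_inj; rewrite val_ordS /=.
by rewrite ltn_eqF.
Qed.

Lemma cycle_exC1 : exC setT 1.
Proof.
apply/exC_1P => // h hU; exists (h (c i0)) => x _.
rewrite -(permKV c x); apply: (cycle_const hU) => //.
Qed.

Lemma cycle_not_exC : ~ exC setT 2.
Proof.
have l1 : (1 < n)%N by apply: leq_trans n4.
have lm : (n.-1 < n)%N by rewrite prednK.
pose i1 := Ordinal l1; pose im := Ordinal lm; pose U := [set~ c i0].
have vU : c i0 \notin U by rewrite !inE eqxx.
have -> : setT = c i0 |: U by rewrite setUCr.
have cU i : (c i \in U) = (val i != 0)%N.
  by rewrite !inE (inj_eq perm_inj) ord_eqE.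
(* The two neighbours of a vertex are not adjacent because the cycle has length at least 4. *)
have ne : ~~ compl_graph e (c i1) (c im).
  rewrite cE !ord_eqE !val_ordS /= prednK // eqxx; case: (eqVneq 2%N n); lia.
have i1m : c i1 != c im by rewrite (inj_eq perm_inj) ord_eqE /=; lia.
apply: (not_exC_suspension e_sym e_irr vU (x := c i1) (y := c im)) => //.
- apply/setP => u; rewrite -(permKV c u); set j := (c^-1)%g u.
  rewrite !inE !(inj_eq perm_inj) !ord_eqE /=.
  have := cE i0 j; rewrite /compl_graph (inj_eq perm_inj) !ord_eqE !val_ordS /=.
  rewrite eq_sym => ->; have := ltn_ord j; case: (eqVneq 1%N n); case: (eqVneq j.+1 n); lia.
- by move: ne; rewrite /compl_graph i1m /= negbK.
apply/exC_1P => // h hU; exists (h (c i1)) => x; rewrite -(permKV c x) cU -lt0n => x0.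
apply: (cycle_const hU (a := 1)) => // i; by rewrite cU lt0n.
Qed.

Lemma cycle_critical W : critical W -> W = setT.
Proof.
(* Without the successor, the link of [c i] in [W] could contain at most the predecessor, so it
   would not be disconnected. *)
move=> cW; have step i : c i \in W -> c (ordS i) \in W.
  move=> iW; apply: NNPP => /negP niW; apply: (critical_link e_sym e_irr cW iW).
  apply: exC_1_small => //.
  suff H u : u \in conbr e (W :\ c i) (c i) -> exists2 j, u = c j & i = ordS j.
    move=> x y /H[j1 -> e1] /H[j2 -> e2]; congr (c _).
    by apply: (can_inj (@ordSK n)); rewrite -e1.
  rewrite -(permKV c u); set j := (c^-1)%g u.
  rewrite !inE => /andP[/andP[ne jW] nej]; exists j => //.
  have := cE i j; rewrite /compl_graph eq_sym ne nej /= => /esym/orP[]/eqP // ji.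
  by move: niW; rewrite -ji jW.
have [v vW] := critical_neq0 cW; rewrite -(permKV c v) in vW; set i := (c^-1)%g v in vW.
have it m : c (iter m (@ordS n) i) \in W by elim: m => //= m; apply: step.
have vit m : iter m (@ordS n) i = ((i + m) %% n)%N :> nat.
  elim: m => [|m IH] /=; first by rewrite addn0 modn_small.
  by rewrite IH -addn1 modnDml addn1 addnS.
apply/setP => u; rewrite [RHS]inE -(permKV c u); set j := (c^-1)%g u.
have -> : j = iter (n - i + j) (@ordS n) i; last exact: it.
apply: ord_inj; rewrite vit addnA subnKC; last exact: ltnW.
by rewrite modnDl modn_small.
Qed.

Lemma cycle_exC U k : (1 < k)%N -> (U != setT) || (k != 2%N) -> exC U k.
Proof.
move=> k1 Uk; have [k2|k2] := eqVneq k 2%N.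
  rewrite k2 eqxx orbF in Uk; apply: NNPP => hU; have [W WU cW] := exists_critical e_sym e_irr k1 hU.
  by move: Uk; rewrite -subTset -(cycle_critical cW) WU.
(* A face with three elements would contain a triangle, and a cycle of length at least 4 has
   none. *)
apply: exC_no_face => s sU st sk.
have : (2 < #|s|)%N by rewrite sk ltn_neqAle eq_sym k2.
case/card_gt2P => a [b [d [[]]]].
rewrite -(permKV c a) -(permKV c b) -(permKV c d).
set i := (c^-1)%g a; set j := (c^-1)%g b; set l := (c^-1)%g d => ai aj al [ij jl li].
have adj p q : c p \in s -> c q \in s -> c p != c q -> (q == ordS p) || (p == ordS q).
  by move=> ps qs pq; rewrite -cE /compl_graph pq /=; apply: (stableP _ _ st).
have := adj _ _ ai aj ij; have := adj _ _ aj al jl; have := adj _ _ al ai li.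
move: ij jl li; rewrite !(inj_eq perm_inj) !ord_eqE !val_ordS /=.
have := ltn_ord i; have := ltn_ord j; have := ltn_ord l.
case: (eqVneq i.+1 n); case: (eqVneq j.+1 n); case: (eqVneq l.+1 n); lia.
Qed.

End CycleGraph.
End Cycle.

(** * From critical vertex sets to induced cycles *)

Lemma nth_take_last (T : Type) (x0 x : T) (p : seq T) i : (i <= size p)%N ->
  last x (take i p) = nth x0 (x :: p) i.
Proof.
move=> ip; rewrite (last_nth x0) size_takel // -[x :: take i p]/(take i.+1 (x :: p)).
by rewrite nth_take.
Qed.

Lemma path_shortcut (T : Type) (r : rel T) (x0 x : T) (p : seq T) i j :
  path r x p -> (i < j)%N -> (j <= size p)%N -> r (nth x0 (x :: p) i) (nth x0 (x :: p) j) ->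
  exists p', [/\ path r x p', last x p' = last x p & size p' = (i + (size p - j).+1)%N].
Proof.
move=> xp ij js rij; have is_ : (i <= size p)%N by apply: leq_trans (ltnW ij) js.
have lastj := nth_take_last x0 x js.
exists (take i p ++ nth x0 (x :: p) j :: drop j p); split.
- rewrite cat_path /= (nth_take_last x0) // rij take_path //= -lastj.
  by move: xp; rewrite -{1}(cat_take_drop j p) cat_path => /andP[].
- by rewrite last_cat /= -lastj -last_cat cat_take_drop.
- by rewrite size_cat size_takel //= size_drop.
Qed.

Section FindCycle.
Variables (K : fieldType) (n : nat) (e : rel 'I_n).
Hypotheses (e_sym : ssrbool.symmetric e) (e_irr : irreflexive e).
Implicit Types (s U W : {set 'I_n}) (h : 'I_n -> K) (v x y : 'I_n).
Notation exC := (exC K e).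
Hypothesis crit : critical K e setT.

(** Otherwise locally constant functions on the link would extend along the components of the
    deletion, and [exC_glue] would remove the cohomology. *)
Lemma critical_jump v : exists (f : {set 'I_n} -> K) x y,
  [/\ locconst e (conbr e [set~ v] v) (vtx f), x \in conbr e [set~ v] v, y \in conbr e [set~ v] v,
      vtx f x != vtx f y &
      connect [rel a b | [&& a \in [set~ v], b \in [set~ v] & compl_graph e a b]] x y].
Proof.
set U := [set~ v]; set N := conbr e U v; set r := (X in connect X).
have vU : v \notin U by rewrite !inE eqxx.
have UT : v |: U = setT by rewrite setUCr.
have [ncT min] := crit.
have exU : exC U 2.
  by apply: min => //; rewrite properT; apply: contraNneq vU => ->; rewrite inE.
apply: NNPP => hno; apply: ncT; rewrite -UT; apply: (exC_glue e_sym e_irr vU) => // f.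
move=> /(cocycle1P e_sym e_irr) fN.
have jump x y : x \in N -> y \in N -> connect r x y -> vtx f x = vtx f y.
  move=> xN yN xy; apply: NNPP => /eqP fxy; apply: hno.
  by exists f, x, y.
(* The value at any link vertex in the component of [u]; components that miss the link get 0. *)
pose g u := if [pick x | (x \in N) && connect r x u] is Some x then vtx f x else 0.
exists (cochain1 g), (fun=> 0); split.
  apply/cocycle1P => // a b aU bU eab; rewrite !vtx_cochain1.
  have [->//|ab] := eqVneq a b.
  have rab : r a b by apply/and3P; split=> //; rewrite /compl_graph ab.
  have rba : r b a by apply/and3P; split=> //; rewrite compl_graph_sym // /compl_graph ab.
  rewrite /g; have -> // : [pick x | (x \in N) && connect r x a] = [pick x | (x \in N) && connect r x b].
  apply: eq_pick => x; congr (_ && _); apply/idP/idP => h.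
    by apply: connect_trans h (connect1 rab).
  by apply: connect_trans h (connect1 rba).
move=> s sN _ /eqP/cards1P[x es]; move: sN; rewrite es sub1set => xN.
rewrite [cobd _ _]cobd_eq0 // addr0; apply: vtx_eq; rewrite vtx_cochain1 /g.
case: pickP => [z /andP[zN zx]|/(_ x)]; last by rewrite xN connect0.
by apply/esym/jump.
Qed.

(* A shortest path joining two vertices of different components of the link
   of [v] closes up, through [v], to an induced cycle. *)
Lemma critical_cycle v : exists q : seq 'I_n,
  [/\ uniq (v :: q), size q = n.-1, (0 < size q)%N,
    forall i, (i < size q)%N -> (nth v q i \in conbr e [set~ v] v) = (i == 0)%N || (i.+1 == size q) &
    forall i j, (i < j)%N -> (j < size q)%N -> compl_graph e (nth v q i) (nth v q j) = (j == i.+1)].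
Proof.
have [f [x0 [y0 [fN x0N y0N f0 con]]]] := critical_jump v.
set U := [set~ v] in fN x0N y0N con; set N := conbr e U v in fN x0N y0N.
set r := (X in connect X) in con.
have vU : v \notin U by rewrite !inE eqxx.
(* The ends range over all link vertices with different values, so that cutting a path at an inner
   link vertex yields a shorter competitor among the two halves. *)
pose P m := exists x p, [/\ x \in N, last x p \in N, vtx f x != vtx f (last x p),
  path r x p & size p = m].
have [m [[x [p0 [xN p0N fp0 xp0 sp0]]] least]] : exists m, P m /\ forall j, P j -> (m <= j)%N.
  apply: ex_least; have /connectP[p xp yp] := con.
  by exists (size p), x0, p; rewrite -yp.
move: p0N fp0; case/shortenP: xp0 => p xp up sub pN fp.
have pm : size p = m.
  have sp : (size p <= m)%N by rewrite -sp0; apply: uniq_leq_size => //; case/andP: up.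
  by apply/eqP; rewrite eqn_leq sp least //; exists x, p.
pose q := x :: p; pose c i := nth v q i.
have cU i : (i <= size p)%N -> c i \in U.
  case: i => [_|i ip]; first by rewrite /c /=; apply: (subsetP (conbrS e U v)).
  by have /(pathP v)/(_ i ip)/and3P[] := xp.
have cS i : (i < size p)%N -> compl_graph e (c i) (c i.+1).
  by move=> ip; have /(pathP v)/(_ i ip)/and3P[] := xp.
have cl : c (size p) = last x p by rewrite (last_nth v).
have chord i j : (i < j)%N -> (j <= size p)%N -> compl_graph e (c i) (c j) = (j == i.+1).
  move=> ij jp; apply/idP/eqP => [cij|je]; last first.
    by rewrite je; apply: cS; rewrite -je.
  have rij : r (nth v q i) (nth v q j).
    by apply/and3P; split; rewrite // cU // (leq_trans (ltnW ij)).
  have [p' [xp' lp' sp']] := path_shortcut xp ij jp rij.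
  have : (m <= size p')%N by apply: least; exists x, p'; rewrite lp'.
  by rewrite sp' -pm => h; apply/eqP; rewrite eqn_leq ij andbT; move: h jp; clear; lia.
have inN i : (i <= size p)%N -> (c i \in N) = (i == 0)%N || (i == size p).
  move=> ip; have [->|i0] := eqVneq i 0%N; first by rewrite /c /= xN.
  have [->|ne] := eqVneq i (size p); first by rewrite cl pN.
  apply/negbTE/negP => ciN.
  have lt : (i < size p)%N by rewrite ltn_neqAle ne.
  have lti : last x (take i p) = c i by apply: nth_take_last.
  have [fi|fi] := eqVneq (vtx f x) (vtx f (c i)).
    have : (m <= size (drop i p))%N.
      apply: least; exists (c i), (drop i p); rewrite -lti -last_cat cat_take_drop lti ciN pN -fi fp.
      by split=> //; move: xp; rewrite -{1}(cat_take_drop i p) cat_path lti => /andP[].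
    by rewrite size_drop -pm; move: i0 ip; rewrite -lt0n; clear; lia.
  have : (m <= size (take i p))%N.
    by apply: least; exists x, (take i p); rewrite lti ciN xN fi take_path.
  by rewrite size_takel // -pm leqNgt lt.
have vq : v \notin q.
  apply/negP => /(nthP v)[i iq vi]; have := cU i iq; rewrite /c vi.
  by rewrite (negbTE vU).
have uq : uniq (v :: q) by rewrite cons_uniq vq.
have xl : x != last x p by apply: contraNneq fp => <-.
have exl : e x (last x p).
  by apply: contraNT fp => h; apply/eqP/fN.
pose U' := [set u in q].
have U'N : conbr e U' v = [set x; last x p].
  apply/setP => u; rewrite !inE; apply/andP/orP => [[uq' evu]|].
    have /(nthP v)[i iq ui] : u \in q by rewrite inE.
    have : c i \in N by rewrite inE cU //= /c ui.
    rewrite inN // => /orP[]/eqP ie; [left|right]; first by rewrite -ui ie.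
    by rewrite -ui ie -cl.
  have xin : last x p \in q by apply: mem_last.
  case=> /eqP->; split.
  - by rewrite eqxx.
  - by move: xN; rewrite inE => /andP[].
  - by move: xin; rewrite inE.
  - by move: pN; rewrite inE => /andP[].
have conU' : exC U' 1.
  apply/exC_1P => // h hl; exists (h x) => u; rewrite inE => /(nthP v)[i iq <-].
  elim: i iq => [|i IH] iq //=; rewrite -IH; last exact: ltnW.
  have ip : (i < size p)%N by [].
  have := cS i ip; rewrite compl_graph_sym // => ad.
  apply: (compl_locconst hl) ad; rewrite inE mem_nth //.
  by rewrite /= ltnW.
have vU' : v \notin U' by rewrite inE.
have [_ min] := crit.
have full : v |: U' = setT.
  (* The closed path already carries cohomology, so criticality of the whole vertex set leaves no
     vertex outside it. *)
  apply/eqP; apply: contraT; rewrite -properT => pr.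
  by case: (not_exC_suspension e_sym e_irr vU' U'N xl exl conU'); apply: min.
exists q; split=> //.
have := congr1 (fun A : {set 'I_n} => #|A|) full; rewrite cardsT card_ord cardsU1 vU' add1n.
have -> : #|U'| = #|q| by apply: eq_card => u; rewrite inE.
have /card_uniqP-> : uniq q by case/andP: uq.
by move/(congr1 predn).
Qed.

Lemma critical_cycle_graph : is_cycle_graph (compl_graph e).
Proof.
have n2 : (2 < n)%N by have := critical_card e_sym e_irr crit; rewrite cardsT card_ord.
have n0 : (0 < n)%N by apply: leq_trans n2.
pose v := Ordinal n0; have [q [uq sq q0 qN qE]] := critical_cycle v.
have sc : size (v :: q) = n by rewrite /= sq prednK.
pose c (i : 'I_n) := nth v (v :: q) i.
have c_inj : injective c.
  move=> i j /eqP; rewrite nth_uniq ?sc // => /eqP h; exact: ord_inj.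
have lt_adj (i j : 'I_n) : (i < j)%N ->
    compl_graph e (c i) (c j) = (j == i.+1 :> nat) || (i == 0 :> nat)%N && (j == n.-1 :> nat).
  case: i j => [[|i] li] [[|j] lj] //=; rewrite /c /= => ij.
    have jq : (j < size q)%N by rewrite sq -ltnS prednK.
    have := qN j jq; rewrite sq eqSS => <-; rewrite !inE /compl_graph.
    by rewrite (eq_sym v).
  by rewrite orbF eqSS qE // sq -ltnS prednK.
exists (perm c_inj) => i j; rewrite !permE !ord_eqE !val_ordS.
have li := ltn_ord i; have lj := ltn_ord j.
have [ij|ji|ij] := ltngtP i j.
- rewrite lt_adj //; case: (eqVneq i.+1 n); case: (eqVneq j.+1 n); lia.
- rewrite compl_graph_sym // lt_adj //; case: (eqVneq i.+1 n); case: (eqVneq j.+1 n); lia.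
- rewrite /compl_graph (ord_inj ij) eqxx /=; case: (eqVneq j.+1 n); lia.
Qed.

End FindCycle.

(** * Projective dimension and index of edge ideals *)

Lemma enat_le_anti x y : enat_le x y -> enat_le y x -> x = y.
Proof.
case: x y => [a|] [b|] //= ab ba; congr Some; apply/eqP.
by rewrite eqn_leq ab.
Qed.

Lemma einf_eq (A : nat -> Prop) d : A d -> (forall r, A r -> (d <= r)%N) -> einf A = Some d.
Proof.
move=> Ad least; have dA : is_einf A (Some d) by split=> // t; apply.
have [h1 h2] := epsilon_spec (inhabits None) (is_einf A) (ex_intro _ _ dA).
by apply: enat_le_anti; [apply: h1 | apply: h2].
Qed.

Lemma esup_exists (A : nat -> Prop) : exists s, is_esup A s.
Proof.
case: (classic (exists b, forall r, A r -> (r <= b)%N)) => [/ex_least[b [hb least]]|no].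
  by exists (Some b); split=> // -[t|] //= /least.
exists None; split=> // -[t|] //= ht; apply: no; by exists t.
Qed.

Lemma esup_eq (A : nat -> Prop) d : A d -> (forall r, A r -> (r <= d)%N) -> esup A = Some d.
Proof.
move=> Ad most; have [h1 h2] := epsilon_spec (inhabits None) (is_esup A) (esup_exists A).
by apply: enat_le_anti; [apply: h2 | apply: h1].
Qed.

(** The supremum of the empty set is [Some 0], so a member [r0] is what makes a finite supremum
    attained. *)
Lemma esup_Some (A : nat -> Prop) d r0 : A r0 -> esup A = Some d ->
  A d /\ forall r, A r -> (r <= d)%N.
Proof.
move=> A0 Ad; have := epsilon_spec (inhabits None) (is_esup A) (esup_exists A).
rewrite -/(esup A) Ad => -[h1 h2]; split=> //; apply: NNPP => nAd.
have lt r : A r -> (r < d)%N.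
  by move=> Ar; rewrite ltn_neqAle (h1 r Ar) andbT; apply: contra_not_neq nAd => <-.
have d0 : (0 < d)%N by apply: leq_ltn_trans (lt r0 A0).
have : (d <= d.-1)%N.
  by apply: (h2 (Some d.-1)) => r /lt /=; rewrite -{1}(prednK d0).
by rewrite leqNgt ltn_predL d0.
Qed.

Lemma mem_sum_mul (R : nzRingType) (n m : nat) (c g : 'I_m -> {mpoly R[n]}) x :
  x \in msupp (\sum_(k < m) c k * g k) ->
  exists k x1 x2, [/\ x2 \in msupp (g k) & x = (x1 + x2)%MM].
Proof.
move=> /msupp_sum_le/flattenP[_ /mapP[k _ ->]] /msuppM_le/allpairsP[[x1 x2] /= [_ h2 ->]].
by exists k, x1, x2.
Qed.

Lemma projective_rows (K : fieldType) (n r : nat) :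
  projective ('rV[{mpoly K[n]}]_r : lmodType {mpoly K[n]}).
Proof.
move=> M N g f gsurj.
have /choice_fun[b bP] : forall k : 'I_r, exists x, g x = f (delta_mx 0 k).
  by move=> k; apply: gsurj.
pose h (v : 'rV[{mpoly K[n]}]_r) := \sum_k v 0 k *: b k.
have hL : linear h.
  move=> c x y; rewrite /h scaler_sumr -big_split /=; apply: eq_bigr => k _.
  by rewrite !mxE scalerDl scalerA.
pose h' : {linear 'rV[{mpoly K[n]}]_r -> M} := HB.pack h (GRing.isLinear.Build _ _ _ _ h hL).
exists h' => v /=.
rewrite /h linear_sum [in RHS](row_sum_delta v) linear_sum; apply: eq_bigr => k _.
by rewrite !linearZ /= bP.
Qed.

Lemma projective_of_graded (K : fieldType) (n : nat) (J : {mpoly K[n]} -> Prop)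
    (F : graded_free_resolution J) :
  exists G : projective_resolution J,
    forall i, gf_rank F i = 0%N -> forall x : pr_mod G i, x = 0.
Proof.
have pr i : projective ('rV[{mpoly K[n]}]_(gf_rank F i) : lmodType {mpoly K[n]}).
  exact: projective_rows.
have ex0 (x : 'rV_(gf_rank F 0)) : row_form (gf_aug F) x = 0 <->
    exists y, row_map (gf_diff F 0) y = x.
  by rewrite -mulmx_row_form; apply: gf_exact0.
pose E i : lmodType {mpoly K[n]} := 'rV[{mpoly K[n]}]_(gf_rank F i).
exists (@Build_projective_resolution _ J E (row_form (gf_aug F)) (fun i => row_map (gf_diff F i))
  pr (gf_image F) ex0 (@gf_exactS _ _ _ F)) => i /= r0 x.
by apply/rowP => k; have := ltn_ord k; rewrite {2}r0.
Qed.

Section EdgeIdealInvariants.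
Variables (K : fieldType) (n : nat) (e : rel 'I_n).
Hypotheses (e_sym : ssrbool.symmetric e) (e_irr : irreflexive e).
Notation S := {mpoly K[n]}.
Notation I := (@edge_ideal K n e).
Notation exC := (exC K e).
Notation kexI T i := (kex (mfam (edge_mnm e) (pred1 T) : nat -> S^o -> Prop) i).
Implicit Types (U W : {set 'I_n}).

Definition tor_vanishes i := forall U k, #|U| = (k + i.+1)%N -> exC U k.
(** As [I] is generated in degree 2, its linear strand in homological degree [i] is [#|U| = i + 2],
    that is [k = 1]; [k = 0] contributes nothing by [exC_0]. *)
Definition tor_linear i := forall U k, (1 < k)%N -> #|U| = (k + i.+1)%N -> exC U k.

Lemma kexI_vanish i : (forall T, kexI T i) <-> tor_vanishes i.
Proof.
split=> [h U k Uk|h T]; last by apply/kex_edgeP => U k Uk _; apply: h.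
by have /kex_edgeP := h #|U|; apply => //=.
Qed.

Lemma minimal_edge_resolution : exists F : graded_free_resolution I,
  forall d, (forall i, (d < i)%N -> tor_vanishes i) -> forall i, (d < i)%N -> gf_rank F i = 0%N.
Proof.
have up m m' : edge_mnm e m -> edge_mnm e (m + m')%MM.
  case/edge_mnmP => i [j [eij mi mj]]; apply/edge_mnmP; exists i, j.
  by rewrite !mnmDE eij !addn_gt0 mi mj.
have high T i : (n < T)%N -> kexI T i.
  move=> nT; apply/kex_edgeP => U k _ /= /eqP UT; have := max_card (mem U).
  by rewrite card_ord UT leqNgt nT.
have [F FP] := minimal_resolution (edge_idealP e_irr) up high.
exists F => d h; apply: FP => T i di.
by apply/(kexI_vanish i).2/h.
Qed.

Lemma projective_resolution_lengthP d :
  (exists F : projective_resolution I, forall i, (d < i)%N -> forall x : pr_mod F i, x = 0) <->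
  forall i, (d < i)%N -> tor_vanishes i.
Proof.
split=> [[F F0] i di|h].
  have hk : kex (mfam (edge_mnm e) predT : nat -> S^o -> Prop) i.
    apply: kex_ext (kex_proj_res F0 di) => c p; rewrite edge_idealP //.
    by split=> h m /h; rewrite ?andbT.
  by move/kex_edgeP: hk => hk U k Uk; apply: hk.
have [F FP] := minimal_edge_resolution; have [G GP] := projective_of_graded F.
by exists G => i di; apply: GP; apply: FP di.
Qed.

Lemma betti_vanish i T : betti I i T = 0%N <->
  forall U k, #|U| = (k + i.+1)%N -> #|U| = T -> exC U k.
Proof.
have [F _] := minimal_edge_resolution.
rewrite (betti_kex F i T (edge_idealP e_irr)) kex_edgeP; split=> h U k Uk.
  by move=> UT; apply: h; rewrite //= UT.
by move/eqP; apply: h.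
Qed.

Lemma edge_mnm_deg m : edge_mnm e m -> (1 < mdeg m)%N.
Proof.
case/edge_mnmP => i [j [eij mi mj]]; have ij : i != j by apply: contraTneq eij => ->; rewrite e_irr.
rewrite mdegE (bigD1 i) //= (bigD1 j) /=; last by rewrite eq_sym.
by rewrite addnA (leq_trans _ (leq_addr _ _)) // (leq_add mi mj).
Qed.

Lemma edge_ideal_gen2 : (exists i j, e i j) -> generated_in_degree I 2.
Proof.
move=> [i [j eij]].
have gen k l : e k l -> I ('X_k * 'X_l).
  move=> ekl; apply/edge_idealP => // m; rewrite -mpolyXD msuppX inE => /eqP->.
  by apply/edge_mnmP; exists k, l; rewrite ekl !mnmDE !mnm1E !eqxx addn1.
split; first by exists ('X_i * 'X_j); split; [apply: gen | rewrite -mpolyXD; apply/eqP; rewrite -msupp_eq0 msuppX].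
move=> p; split=> [[r [c [g [gE ->]]]]|[r [c [g [gI ->]]]]].
  exists r, c, g; split=> // k; have [a [b [eab ->]]] := gE k; split; first exact: gen.
  by rewrite -mpolyXD; apply/dhomogP => m; rewrite msuppX inE => /eqP->; rewrite /= mdegD !mdeg1.
apply/edge_idealP => // m /mem_sum_mul[k [x1 [x2 [h2 ->]]]].
have [/edge_idealP gk _] := gI k; have /edge_mnmP[a [b [eab xa xb]]] := gk e_irr _ h2.
by apply/edge_mnmP; exists a, b; rewrite eab !mnmDE !addn_gt0 xa xb !orbT.
Qed.

Lemma edge_ideal_degree d : (exists i j, e i j) -> generated_in_degree I d -> d = 2%N.
Proof.
move=> [i [j eij]] [_ /(_ ('X_i * 'X_j))[+ _]].
have gij : I ('X_i * 'X_j).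
  by exists 1%N, (fun=> 1), (fun=> 'X_i * 'X_j); split; [move=> _; exists i, j | rewrite big_ord1 mul1r].
move/(_ gij) => [r [c [g [gI E]]]].
have : (U_(i) + U_(j))%MM \in msupp (\sum_(k < r) c k * g k).
  by rewrite -E -mpolyXD msuppX inE.
case/mem_sum_mul => k [x1 [x2 [h2 e12]]]; have [/edge_idealP gk /dhomogP gd] := gI k.
have := edge_mnm_deg (gk e_irr _ h2); have /= -> := gd _ h2 => d2.
have := congr1 mdeg e12; rewrite !mdegD !mdeg1 (gd _ h2) /=; lia.
Qed.

Lemma steps_linearP r : (exists i j, e i j) ->
  steps_linear I r <-> forall i, (i <= r)%N -> tor_linear i.
Proof.
move=> ne; split=> [[d [/(edge_ideal_degree ne)->] h] i ir U k k1 Uk|h].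
  have /betti_vanish := h i k.+1 ir k1; apply => //.
  by rewrite Uk !addnS addnC.
exists 2%N; split; first exact: edge_ideal_gen2.
move=> i j ir j2; apply/betti_vanish => U k Uk UT; apply: (h i ir) => //.
by move: j2; rewrite Uk in UT; lia.
Qed.

(** The edges generate: if [U] has at least three elements and contains an edge, removing a vertex
    [v] off that edge keeps it, so [v] is a vertex of the upper complex and coning with it fills the
    empty face. *)
Lemma tor_linear0 : tor_linear 0.
Proof.
move=> U k k1 Uk; apply/(exA_exC K e Uk) => f fA f0.
have [fz|fz] := eqVneq (f set0) 0.
  exists (fun=> 0); split=> s; first by rewrite eqxx.
  rewrite bdry_eq0 //; apply/esym/eqP/negPn/negP => fs; case/negP: (fs).
  by have [_ /cards0_eq->] := fA s fs; rewrite fz.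
have [/andP[_ nst] _] := fA _ fz; rewrite setD0 in nst.
have [i [j [iU jU eij]]] : exists i j, [/\ i \in U, j \in U & e i j].
  apply: NNPP => h; case/negP: nst; apply/stableP => i j iU jU; apply/negP => eij; apply: h.
  by exists i, j.
have [v vU vij] : exists2 v, v \in U & v \notin [set i; j].
  apply/subsetPn/negP => /subset_leq_card; rewrite Uk cards2.
  by case: (i != j); move: k1; clear; lia.
exists (cone v f); split=> s; last first.
  by rewrite bdry_cone /cone f0 mulr0; case: ifP; rewrite subr0.
rewrite /cone; case: ifPn => vs; last by rewrite eqxx.
rewrite mulf_eq0 negb_or => /andP[_ /fA[_ /cards0_eq s0]].
have -> : s = [set v] by rewrite -(setD1K vs) s0 setU0.
split; last exact: cards1.
rewrite /upper sub1set vU; apply/stableP => /(_ i j); rewrite !inE iU jU eij !andbT.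
move: vij; rewrite !inE negb_or eq_sym (eq_sym v) => /andP[-> ->].
by move/(_ isT isT).
Qed.

End EdgeIdealInvariants.

(** * The two implications *)

Section Equivalence.
Variables (K : fieldType) (n : nat) (e : rel 'I_n).
Hypotheses (hn : (4 <= n)%N) (e_sym : ssrbool.symmetric e) (e_irr : irreflexive e).
Hypothesis e_no_isolated : forall i, exists j, e i j.
Notation S := {mpoly K[n]}.
Notation I := (@edge_ideal K n e).
Notation exC := (exC K e).
Implicit Types (U W : {set 'I_n}).

Let has_edge : exists i j, e i j.
Proof.
have n0 : (0 < n)%N by apply: leq_trans hn.
by exists (Ordinal n0).
Qed.

Lemma proj_dim_eq d : (forall i, (d < i)%N -> tor_vanishes K e i) ->
  (forall d', (forall i, (d' < i)%N -> tor_vanishes K e i) -> (d <= d')%N) ->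
  proj_dim I = Some d.
Proof.
move=> hd least; apply: einf_eq; first exact/projective_resolution_lengthP.
by move=> d' /(projective_resolution_lengthP K e_irr); apply: least.
Qed.

Lemma proj_dim_exists : exists d, [/\ proj_dim I = Some d,
  forall i, (d < i)%N -> tor_vanishes K e i &
  forall d', (forall i, (d' < i)%N -> tor_vanishes K e i) -> (d <= d')%N].
Proof.
have [|d [hd least]] := @ex_least (fun d => forall i, (d < i)%N -> tor_vanishes K e i).
  exists n => i ni U k Uk; have := max_card (mem U).
  by rewrite card_ord Uk; move: ni; clear; lia.
by exists d; split=> //; apply: proj_dim_eq.
Qed.

Lemma cycle_proj_dim : is_cycle_graph (compl_graph e) -> proj_dim I = Some (n - 3)%N.
Proof.
move=> [c cE]; apply: proj_dim_eq => [i ni U k Uk|d hd].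
  (* For [i] above [n - 3], a [k] of at least 2 needs more than [n] vertices, and [k = 1] needs all
     of them, where the cycle is connected. *)
  have Un : (#|U| <= n)%N by rewrite -[X in (_ <= X)%N]card_ord max_card.
  case: k Uk => [|[|k]] Uk; last by move: Uk Un ni hn; clear; lia.
    by apply: exC_0 => //; rewrite -card_gt0 Uk.
  have -> : U = setT.
    apply/eqP; rewrite eqEcard subsetT cardsT card_ord Uk.
    by move: ni hn; clear; lia.
  exact: cycle_exC1 cE.
rewrite leqNgt; apply/negP => dn; apply: (cycle_not_exC (K := K) e_sym e_irr hn cE).
by apply: (hd _ dn); rewrite cardsT card_ord; move: hn; clear; lia.
Qed.

Lemma cycle_lin_index : is_cycle_graph (compl_graph e) -> lin_index I = Some (n - 3)%N.
Proof.
(* The class of the whole cycle has [k = 2], so it obstructs linearity at [i = n - 3]; the supremum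
   is one less, and the index adds 1 back. *)
move=> [c cE]; rewrite /lin_index (@esup_eq _ (n - 4)%N) /=.
- by congr Some; move: hn; clear; lia.
- apply/steps_linearP => // i ir U k k1 Uk; apply: (cycle_exC e_sym e_irr hn cE) => //.
  apply/norP => -[/negPn/eqP UT /negPn/eqP k2]; move: Uk.
  by rewrite UT k2 cardsT card_ord; move: ir hn; clear; lia.
move=> r /(steps_linearP K e_irr _ has_edge) hr; rewrite leqNgt; apply/negP => nr.
apply: (cycle_not_exC (K := K) e_sym e_irr hn cE).
apply: (hr (n - 3)%N) => //; first by move: nr hn; clear; lia.
by rewrite cardsT card_ord; move: hn; clear; lia.
Qed.

Section EqualInvariants.
Variable d : nat.
Hypotheses (van : forall i, (d < i)%N -> tor_vanishes K e i).
Hypothesis lin : forall i, (i < d)%N -> tor_linear K e i.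

(** With [k = 2], the cohomology of [W] is a nonlinear Tor in homological degree [#|W| - 3], which
    is not above [d] by [van] and not below by [lin]. *)
Lemma critical_card_eq W : critical K e W -> #|W| = d.+3.
Proof.
move=> cW; have W3 := critical_card e_sym e_irr cW; have [ncW _] := cW.
have WE : #|W| = (2 + (#|W| - 3).+1)%N by move: W3; clear; lia.
have h1 : (#|W| - 3 <= d)%N.
  by rewrite leqNgt; apply/negP => /van h; apply: ncW; apply: h WE.
have h2 : (d <= #|W| - 3)%N.
  by rewrite leqNgt; apply/negP => /lin h; apply: ncW; apply: h WE.
by move: W3 h1 h2; clear; lia.
Qed.

(* Otherwise two adjacent vertices outside [W] would span, with [W], the
   suspension of the independence complex of [W]. *)
Lemma critical_full W : critical K e W -> W = setT.
Proof.
move=> cW; have Wd := critical_card_eq cW; have [ncW min] := cW.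
(* With one more vertex, [k = 2] means homological degree [d.+1], where Tor vanishes; a proper link
   would pass the vanishing on to [W]. *)
have outside v : v \notin W -> conbr e W v = W.
  move=> vW; apply: NNPP => /eqP ne; apply: ncW; apply: (exC_del e_sym e_irr vW).
    by apply: (van (i := d.+1)) => //; rewrite cardsU1 vW Wd.
  by apply: min => //; rewrite properEneq ne conbrS.
apply: NNPP => /eqP; rewrite -subTset => /subsetPn[v _ vW].
have [w evw] := e_no_isolated v.
have nadj u x : u \notin W -> x \in W -> ~~ e u x.
  by move=> /outside <-; rewrite inE => /andP[].
have wW : w \notin W.
  by apply/negP => wW; have := nadj v w vW wW; rewrite evw.
have wU : w \notin v |: W.
  rewrite !inE negb_or wW andbT; apply: contraTneq evw => ->; by rewrite e_irr.
apply: ncW; have <- : conbr e (v |: W) w = W.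
  apply/setP => u; rewrite !inE; case: eqVneq => [->|_] /=.
    by rewrite e_sym evw (negbTE vW).
  by apply/andb_idr/nadj.
(* With two more vertices, [k = 3] again means homological degree [d.+1], as d + 5 = 3 + (d + 1) +
   1. *)
apply: (exC_link e_sym e_irr wU).
  by apply: (van (i := d.+1)) => //; rewrite cardsU1 vW Wd.
by apply: (van (i := d.+1)) => //; rewrite !cardsU1 wU vW Wd.
Qed.

End EqualInvariants.

Lemma equal_cycle : lin_index I = proj_dim I -> is_cycle_graph (compl_graph e).
Proof.
have [d [-> van least]] := proj_dim_exists.
rewrite /lin_index; case E: (esup _) => [r|] //= [rd].
have st0 : steps_linear I 0.
  by apply/steps_linearP => // i; rewrite leqn0 => /eqP->; apply: tor_linear0.
have [/(steps_linearP K e_irr _ has_edge) hr most] := esup_Some st0 E.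
have lin i : (i < d)%N -> tor_linear K e i by rewrite -rd ltnS; apply: hr.
(* The index is finite here, which excludes a linear resolution. *)
have [U [k [k1 hU]]] : exists U k, (1 < k)%N /\ ~ exC U k.
  apply: NNPP => h; have : steps_linear I d.
    apply/steps_linearP => // i _ U k k1 _; apply: NNPP => hU; apply: h.
    by exists U, k.
  by move/most; rewrite -rd ltnn.
have [W _ cW] := exists_critical e_sym e_irr k1 hU.
have WT := critical_full van lin cW.
by apply: (critical_cycle_graph (K := K)) => //; rewrite -WT.
Qed.

End Equivalence.

Local Close Scope ring_scope.

Theorem theorem3p1 (K : fieldType) (n : nat) (hn : 4 <= n)
    (e : rel 'I_n) (e_sym : ssrbool.symmetric e) (e_irr : irreflexive e)
    (e_no_isolated : forall i, exists j, e i j) :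
  let I := @edge_ideal K n e in
  (is_cycle_graph (compl_graph e) <-> lin_index I = proj_dim I) /\
  (is_cycle_graph (compl_graph e) -> proj_dim I = Some (n - 3)).
Proof.
move=> I; split; last exact: cycle_proj_dim.
split; last exact: equal_cycle.
by move=> h; rewrite cycle_lin_index // cycle_proj_dim.
Qed.
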